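(* Consider a Markov jump process on a standard Borel space $S$ with generator $Lf(x)=\int(f(y)-f(x))\,q(x,dy)$, an invariant probability measure $\mu$, and jump rates bounded by $q(x,S)\le q_{\max}<\infty$ for $\mu$-a.e. $x$, with $q_{\max}>0$. Let $\gamma:=\inf_{f\in L^2_0(\mu)\setminus\{0\}}\|Lf\|/\|f\|$ be the associated singular-value gap, and let $\xi$ be the Cheeger constant $$\xi:=\inf_{A\subset S\text{ measurable}:\ 0<\mu(A)\le\frac12}\frac{Q(A,A^c)}{\mu(A)},\qquad Q(dx,dy):=\mu(dx)\,q(x,dy),$$ where $Q(A,B)=\int_A q(x,B)\,\mu(dx)$. Then $$\frac{\xi^2}{2q_{\max}}\le\gamma\le\frac{36}{5}\,\xi.$$
   Context: The jump kernel $q(x,dy)$ is such that $q(x,\cdot)$ is a finite measure on $S$ for each $x$ and $x\mapsto q(x,A)$ is measurable for each measurable $A$. $L^2(\mu)$ is the space of complex-valued square-integrable functions with norm $\|\cdot\|$; $L^2_0(\mu)=\{g\in L^2(\mu):\int g\,d\mu=0\}$. Invariance of $\mu$ means $\int Lh\,d\mu=0$ for every bounded measurable $h$. With bounded rates, $L$ is a bounded operator on $L^2(\mu)$. Convention: $\inf\emptyset=+\infty$. *)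

(* Defs.v *)
From HB Require Import structures.
From mathcomp Require Import all_boot all_order all_algebra.
From mathcomp Require Import all_classical all_reals all_analysis.
From mathcomp Require Export complex.

Set Implicit Arguments.
Unset Strict Implicit.
Unset Printing Implicit Defensive.

Import Order.TTheory GRing.Theory Num.Theory.
Import numFieldNormedType.Exports.

Local Open Scope classical_set_scope.
Local Open Scope ring_scope.

(* Hausdorff and completely (pseudo)metrized means completely metrizable, so
   [T] ranges over the (nonempty) Polish spaces; [f] is a Borel isomorphism. *)
Definition standard_borel (R : realType) (d : measure_display)
    (S : measurableType d) : Prop :=
  exists (T : completePseudoMetricType R) (f : S -> T),
    [/\ hausdorff_space T,
        (exists2 D : set T, countable D & dense D),
        bijective f &
        forall A : set S, measurable A <-> <<s [set U : set T | open U] >> (f @` A)].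

Section complex_functions.
Context {R : realType} {d : measure_display} {S : measurableType d}.
Implicit Types (nu : {measure set S -> \bar R}) (f : S -> R[i]).

(* Equivalently, measurability for the Borel sets of the plane. *)
Definition cmeasurable f : Prop :=
  measurable_fun setT (fun x => complex.Re (f x)) /\
  measurable_fun setT (fun x => complex.Im (f x)).

Definition cbounded f : Prop :=
  exists M : R, forall x, ComplexField.Normc.normc (f x) <= M.

(* [Rintegral] is total: this is meaningful when [f] is integrable. *)
Definition cintegral nu f : R[i] :=
  Complex (\int[nu]_x complex.Re (f x)) (\int[nu]_x complex.Im (f x)).

Definition L2norm nu f : \bar R :=
  Lnorm nu 2%:E (fun x => (ComplexField.Normc.normc (f x))%:E).

(* Elements of L^2(nu) are represented by functions rather than classes. *)
Definition L2 nu : set (S -> R[i]) :=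
  [set f | cmeasurable f /\ (L2norm nu f < +oo)%E].

Definition L20 nu : set (S -> R[i]) :=
  [set f | L2 nu f /\ cintegral nu f = 0].

End complex_functions.

Section jump_process.
Context {R : realType} {d : measure_display} {S : measurableType d}.
Implicit Types (mu : {measure set S -> \bar R}) (q : R.-ker S ~> S).

(* For [f] in L^2(mu), with [mu] invariant and the rates essentially bounded,
   [f] is [q x]-integrable for mu-almost every [x]; the junk values at the
   remaining points do not affect the L^2(mu) norm of [jump_generator q f]. *)
Definition jump_generator q (f : S -> R[i]) : S -> R[i] :=
  fun x => cintegral (q x) (fun y => f y - f x).

Definition invariant_measure q mu : Prop :=
  forall h : S -> R[i], cmeasurable h -> cbounded h ->
    cintegral mu (jump_generator q h) = 0.

Definition edge_flow q mu (A B : set S) : \bar R :=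
  (\int[mu]_(x in A) q x B)%E.

(* [f] is nonzero in L^2(mu), that is, not mu-almost everywhere zero. *)
Definition singular_value_gap q mu : \bar R :=
  ereal_inf [set r | exists f : S -> R[i],
    [/\ L20 mu f, ~ {ae mu, forall x, f x = 0} &
        r = (L2norm mu (jump_generator q f) / L2norm mu f)%E]].

Definition cheeger_constant q mu : \bar R :=
  ereal_inf [set r | exists A : set S,
    [/\ measurable A, (0 < mu A)%E, (mu A <= (2^-1)%:E)%E &
        r = (edge_flow q mu A (~` A) / mu A)%E]].

End jump_process.

(* Main.v *)
Require Import Defs.
From HB Require Import structures.
From mathcomp Require Import all_boot all_order all_algebra.
From mathcomp Require Import all_classical all_reals all_analysis.
From mathcomp Require Import measurable_realfun ring lra.

Set Implicit Arguments.
Unset Strict Implicit.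
Unset Printing Implicit Defensive.

Import Order.TTheory GRing.Theory Num.Theory.
Import numFieldNormedType.Exports.

Local Open Scope classical_set_scope.
Local Open Scope ring_scope.

(** The lower bound is Cheeger's argument for the additive symmetrization of
    the generator. Since the generator [L] maps real functions to real
    functions, real and imaginary parts can be treated separately, so let [u]
    be real with mean zero. Invariance of [mu] says that the two marginals of
    the edge measure [Q] agree, whence
      [- <u, L u> = 1/2 * D(u)], [D(u) = int (u x - u y)^2 dQ].
    Cheeger's inequality [D(u) >= (xi^2 / qmax) * |u|^2] holds even for a
    nonsymmetric [Q]: the coarea formula for the superlevel sets of [g^2], where
    [g] is the positive or the negative part of [u - m] and [m] is a median
    of [u] (so that these sets have mass at most one half), gives
      [xi * |g|^2 <= int (g(x)^2 - g(y)^2)^+ dQ],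
    and the arithmetic-geometric mean inequality turns this into a lower bound
    on [D(g)]; the cross terms of [D(u)] have a favourable sign. Finally
    [- <u, L u> <= |u| |L u|]. The lemmas are [coarea], [median_exists],
    [dirichlet_half], [dirichlet_poincare] and [real_generator_lower].

    The upper bound is linear in [xi], which the indicator of a nearly optimal
    set [A] cannot give: [|L 1_A|] is only of order [sqrt xi]. The test
    function is the smoothed indicator [v = lam (lam - L)^-1 1_A], where
    [lam] is eight times a bound on the flow ratio of [A]: since
    [L v = lam (v - 1_A)], the quotient [|L v| / |v - mu A|] is [lam] times the relative distance of
    [v] from [1_A], and that distance is bounded by a constant because [v]
    has lost only one eighth of its mass on [A] ([cheeger_test_functionP]).
    The resolvent of a bounded generator is an increasing limit of iterates of
    a positive operator ([resolventE]), so no spectral theory is involved.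

    The rates are bounded only almost everywhere. Replacing [q x] by the
    zero measure at the exceptional points [x] changes neither the gap nor the
    Cheeger constant and gives a kernel whose rates are bounded everywhere. *)

(** * Truncation of the rates and the edge measure *)

Section truncated_kernel.
Context {R : realType} {d : measure_display} {S : measurableType d}.
Variables (q : R.-ker S ~> S) (M : R).
Hypothesis M_ge0 : 0 <= M.

Definition bounded_rate : set S := [set x | (q x setT <= M%:E)%E].

Lemma measurable_bounded_rate : measurable bounded_rate.
Proof.
rewrite /bounded_rate -[X in measurable X]setTI.
by apply: emeasurable_fun_infty_c => //; exact: measurable_kernel.
Qed.

(** Points with rate above [M] are frozen. *)
Definition truncated_kernel (x : S) : {measure set S -> \bar R} :=
  if x \in bounded_rate then q x else mzero.

Lemma truncated_kernel_in x : bounded_rate x -> truncated_kernel x = q x.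
Proof. by move=> xG; rewrite /truncated_kernel mem_set. Qed.

Lemma measurable_truncated_kernel U :
  measurable U -> measurable_fun setT (truncated_kernel ^~ U).
Proof.
move=> mU; rewrite [X in measurable_fun _ X](_ : _ = (q ^~ U) \_ bounded_rate).
  apply/(measurable_restrictT _ measurable_bounded_rate).
  by apply: measurable_funTS; exact: measurable_kernel.
apply/funext => x; rewrite /truncated_kernel patchE.
by case: (x \in bounded_rate).
Qed.

HB.instance Definition _ :=
  isKernel.Build _ _ _ _ _ truncated_kernel measurable_truncated_kernel.

Lemma truncated_kernel_le x : (truncated_kernel x setT <= M%:E)%E.
Proof.
by rewrite /truncated_kernel; case: ifPn => [/set_mem//|_]; rewrite lee_fin.
Qed.

End truncated_kernel.

Section truncated_kernel_finite.
Context {R : realType} {d : measure_display} {S : measurableType d}.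
Variables (q : R.-ker S ~> S) (M : {nonneg R}).

Let truncated_kernel_uub : measure_fam_uub (truncated_kernel q M%:num).
Proof.
exists (M%:num + 1) => x; apply: le_lt_trans (truncated_kernel_le _ _ _) _ => //.
by rewrite lte_fin ltrDl.
Qed.

HB.instance Definition _ := Kernel_isFinite.Build _ _ _ _ R
  (truncated_kernel q M%:num) truncated_kernel_uub.

End truncated_kernel_finite.

Section edge_measure.
Context {R : realType} {d : measure_display} {S : measurableType d}.
Variables (q : R.-fker S ~> S) (mu : probability S R).

(** From [x], the law of the pair [(x, y)] with [y] drawn from [q x]; the dummy
    component of type [unit] gives it the shape of the second factor of a
    composition of kernels, so that integration against the edge measure is an
    instance of integration against a composite kernel. *)
Definition graph_kernel_fun (z : unit * S) : set (S * S) -> \bar R :=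
  pushforward (q z.2) (pair z.2 : S -> (S * S)%type).

Let measurable_preimage_pair x (U : set (S * S)) :
  measurable U -> measurable (pair x @^-1` U).
Proof.
by move=> mU; rewrite -[X in measurable X]setTI; exact: measurable_pair1.
Qed.

Let graph_kernel0 z : graph_kernel_fun z set0 = 0%E.
Proof. exact: measure0. Qed.

Let graph_kernel_ge0 z (U : set (S * S)) : (0 <= graph_kernel_fun z U)%E.
Proof. exact: measure_ge0. Qed.

Let graph_kernel_sigma_additive z : semi_sigma_additive (graph_kernel_fun z).
Proof.
move=> F mF tF mUF; rewrite /graph_kernel_fun /pushforward preimage_bigcup.
apply: measure_semi_sigma_additive.
- by move=> n; exact: measurable_preimage_pair.
- apply/trivIsetP => /= i j _ _ ij; rewrite -preimage_setI.
  by move/trivIsetP : tF => /(_ _ _ _ _ ij) ->//; rewrite preimage_set0.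
- by rewrite -preimage_bigcup; exact: measurable_preimage_pair.
Qed.

HB.instance Definition _ z := isMeasure.Build _ _ _ (graph_kernel_fun z)
  (graph_kernel0 z) (@graph_kernel_ge0 z) (@graph_kernel_sigma_additive z).

Definition graph_kernel (z : unit * S) : {measure set (S * S) -> \bar R} :=
  graph_kernel_fun z.

Let measurable_graph_kernel U :
  measurable U -> measurable_fun setT (graph_kernel ^~ U).
Proof.
move=> mU; rewrite [X in measurable_fun _ X](_ : _ = (fun x => q x (xsection U x)) \o snd).
  apply: measurableT_comp => //.
  by apply: measurable_fun_xsection_finite_kernel; rewrite inE.
by apply/funext => -[t x]; rewrite /= /pushforward xsectionE.
Qed.

HB.instance Definition _ :=
  isKernel.Build _ _ _ _ _ graph_kernel measurable_graph_kernel.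

Let graph_kernel_uub : measure_fam_uub graph_kernel.
Proof. by have [r qr] := measure_uub q; exists r => z; exact: qr. Qed.

HB.instance Definition _ :=
  Kernel_isFinite.Build _ _ _ _ R graph_kernel graph_kernel_uub.

Definition const_kernel : R.-pker unit ~> S :=
  kprobability (measurable_cst (mu : pprobability S R)).

(** The measure [Q(dx, dy) = mu(dx) q(x, dy)]. *)
Definition edge_measure : set (S * S) -> \bar R :=
  mkcomp const_kernel graph_kernel tt.

HB.instance Definition _ := Measure.on edge_measure.

Let edge_measure_fin_num : fin_num_fun edge_measure.
Proof.
have [r qr] := measure_uub q.
apply: lty_fin_num_fun; apply: (@le_lt_trans _ _ (\int[mu]__ r%:E)%E).
  apply: ge0_le_integral => //; last by move=> x _; exact/ltW/qr.
  exact: measurable_kernel measurableT.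
by rewrite integral_cst//= probability_setT mule1 ltry.
Qed.

HB.instance Definition _ :=
  @Measure_isFinite.Build _ _ _ edge_measure edge_measure_fin_num.

Lemma integral_edge_measure (f : S * S -> \bar R) :
  measurable_fun setT f -> (forall z, 0 <= f z)%E ->
  (\int[edge_measure]_z f z = \int[mu]_x \int[q x]_y f (x, y))%E.
Proof.
move=> mf f0; rewrite /edge_measure integral_kcomp//.
apply: eq_integral => x _.
by rewrite ge0_integral_pushforward.
Qed.

End edge_measure.

(** * Real generator and balance of the edge measure *)

Section real_generator.
Context {R : realType} {d : measure_display} {S : measurableType d}.
Implicit Types (q : S -> {measure set S -> \bar R}) (f h : S -> R).

Definition real_generator q f (x : S) : R := (\int[q x]_y (f y - f x))%R.

Definition sup_bounded f := exists B : R, forall x, `|f x| <= B.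

Definition real_invariant q (mu : {measure set S -> \bar R}) := forall h,
  measurable_fun setT h -> sup_bounded h -> \int[mu]_x real_generator q h x = 0.

Lemma integrable_sup_bounded (nu : {measure set S -> \bar R}) f :
  (nu setT < +oo)%E -> measurable_fun setT f -> sup_bounded f ->
  nu.-integrable setT (EFin \o f).
Proof.
move=> nuoo mf [B fB]; apply: measurable_bounded_integrable => //.
by exists B; split; [exact: num_real|move=> y By x _; exact: le_trans (ltW By)].
Qed.

Lemma real_generatorE q f x : (q x setT < +oo)%E ->
  (q x).-integrable setT (EFin \o f) ->
  real_generator q f x = \int[q x]_y f y - f x * fine (q x setT).
Proof.
move=> qoo fi; rewrite /real_generator RintegralB//; last first.
  by apply: integrable_sup_bounded => //; exists `|f x|.
by rewrite Rintegral_cst.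
Qed.

End real_generator.

Section balance.
Context {R : realType} {d : measure_display} {S : measurableType d}.
Variables (q : R.-fker S ~> S) (mu : probability S R) (M : R).
Hypothesis q_le : forall x, (q x setT <= M%:E)%E.
Hypothesis inv : real_invariant q mu.

Lemma kernel_total_lty x : (q x setT < +oo)%E.
Proof. by rewrite (le_lt_trans (q_le x)) ?ltry. Qed.

Lemma kernel_lty x A : measurable A -> (q x A < +oo)%E.
Proof.
by move=> mA; rewrite (le_lt_trans _ (kernel_total_lty x)) ?le_measure ?inE.
Qed.

Lemma kernel_fin_num x A : measurable A -> q x A \is a fin_num.
Proof. by move=> mA; rewrite ge0_fin_numE ?kernel_lty. Qed.

Lemma edge_measure_fst (g : S -> \bar R) : measurable_fun setT g ->
  (forall x, 0 <= g x)%E ->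
  (\int[edge_measure q mu]_z g z.1 = \int[mu]_x (g x * q x setT))%E.
Proof.
move=> mg g0; rewrite (integral_edge_measure _ _ (f := g \o fst))//=.
  by apply: eq_integral => x _; rewrite integral_cst.
exact: measurableT_comp.
Qed.

Lemma edge_measure_fst_le (g : S -> \bar R) : measurable_fun setT g ->
  (forall x, 0 <= g x)%E ->
  (\int[edge_measure q mu]_z g z.1 <= M%:E * \int[mu]_x g x)%E.
Proof.
move=> mg g0; rewrite edge_measure_fst// -ge0_integralZl//; last first.
  by rewrite (le_trans _ (q_le point)).
apply: ge0_le_integral => //.
- by move=> x _; rewrite mule_ge0.
- by apply: emeasurable_funM => //; exact: measurable_kernel.
- exact: measurable_funeM.
- by move=> x _; rewrite muleC lee_wpmul2r.
Qed.

Lemma edge_measureX A B : measurable A -> measurable B ->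
  (edge_measure q mu (A `*` B) = \int[mu]_(x in A) q x B)%E.
Proof.
move=> mA mB.
have mAB : measurable (A `*` B) by exact: measurableX.
transitivity (\int[edge_measure q mu]_z (\1_(A `*` B) z)%:E)%E.
  by rewrite integral_indic// setIT.
have mi : measurable_fun setT (fun z => (\1_(A `*` B) z)%:E : \bar R).
  exact/measurable_EFinP.
rewrite (integral_edge_measure _ _ mi); last by move=> z; rewrite lee_fin.
rewrite [RHS]integral_mkcond; apply: eq_integral => x _.
rewrite patchE; case: ifPn => xA.
  transitivity (\int[q x]_y (\1_B y)%:E)%E; last by rewrite integral_indic// setIT.
  by apply: eq_integral => y _; rewrite !indicE in_setX/= xA.
by apply: integral0_eq => y _; rewrite indicE in_setX (negbTE xA).
Qed.

(** Invariance tested on the indicator of [A]: the mass that jumps into [A],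
    counting jumps inside [A], is the mass that jumps from [A]. *)
Lemma edge_measure_balance_set A : measurable A ->
  edge_measure q mu (setT `*` A) = edge_measure q mu (A `*` setT).
Proof.
move=> mA; rewrite !edge_measureX//.
have mq B : measurable B -> measurable_fun setT (fun x => fine (q x B)).
  by move=> mB; apply: measurableT_comp => //; exact: measurable_kernel.
have bq B : measurable B -> sup_bounded (fun x => fine (q x B)).
  move=> mB; exists M => x; rewrite ger0_norm ?fine_ge0// -lee_fin fineK.
    by rewrite (le_trans _ (q_le x)) ?le_measure ?inE.
  exact: kernel_fin_num.
have m1 : measurable_fun setT (\1_A : S -> R) by [].
have b1 : sup_bounded (\1_A : S -> R).
  exists 1 => x; rewrite indicE; case: (x \in A); rewrite ?normr1 ?normr0//.
have muoo : (mu setT < +oo)%E by rewrite probability_setT ltry.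
have iT : mu.-integrable setT (EFin \o (fun x => \1_A x * fine (q x setT))).
  apply: integrable_sup_bounded => //; first by apply: measurable_funM => //; exact: mq.
  case: b1 (bq setT measurableT) => B1 hB1 [B2 hB2]; exists (B1 * B2) => x.
  by rewrite normrM ler_pM.
have iA : mu.-integrable setT (EFin \o (fun x => fine (q x A))).
  by apply: integrable_sup_bounded => //; [exact: mq|exact: bq].
have E : (\int[mu]_x (fine (q x A))%:E = \int[mu]_x (\1_A x * fine (q x setT))%:E)%E.
  rewrite -[LHS]fineK ?(integrable_fin_num _ iA)//.
  rewrite -[RHS]fineK ?(integrable_fin_num _ iT)//; congr EFin.
  apply/eqP; rewrite -subr_eq0; apply/eqP; rewrite -[RHS](inv m1 b1).
  rewrite -(RintegralB measurableT iA iT); apply: eq_Rintegral => x _.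
  rewrite real_generatorE ?kernel_total_lty//.
    by rewrite /Rintegral integral_indic// setIT.
  by apply: integrable_sup_bounded => //; exact: kernel_total_lty.
rewrite [LHS](_ : _ = \int[mu]_x (fine (q x A))%:E)%E; last first.
  by apply: eq_integral => x _; rewrite fineK// kernel_fin_num.
rewrite E [RHS]integral_mkcond; apply: eq_integral => x _.
rewrite patchE indicE; case: ifPn => xA; last by rewrite mul0r.
by rewrite mul1r fineK ?kernel_fin_num.
Qed.

(** The two marginals of the edge measure agree: the form in which invariance
    enters the lower bound. *)
Lemma edge_measure_balance (g : S -> \bar R) : measurable_fun setT g ->
  (forall x, 0 <= g x)%E ->
  (\int[edge_measure q mu]_z g z.2 = \int[edge_measure q mu]_z g z.1)%E.
Proof.
move=> mg g0.
have m1 : measurable_fun [set: S * S] (@fst S S) by [].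
have m2 : measurable_fun [set: S * S] (@snd S S) by [].
transitivity (\int[pushforward (edge_measure q mu) snd]_x g x)%E.
  by rewrite (ge0_integral_pushforward m2).
transitivity (\int[pushforward (edge_measure q mu) fst]_x g x)%E; last first.
  by rewrite (ge0_integral_pushforward m1).
apply: (eq_measure_integral (pushforward (edge_measure q mu) fst)) => A mA _.
have := edge_measure_balance_set mA.
by rewrite setTX setXT.
Qed.

End balance.

(** * Coarea inequality *)

Section layer_cake.
Context {R : realType} {d : measure_display} {T : measurableType d}.
Local Notation leb := (@lebesgue_measure R).

Lemma measurable_between (f g : T -> R) :
  measurable_fun setT f -> measurable_fun setT g ->
  measurable [set z : T * measurableTypeR R | f z.1 <= z.2 < g z.1].
Proof.
move=> mf mg.
have mfg : measurable_fun [set: T * measurableTypeR R]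
    (fun z => (f z.1 <= z.2) && (z.2 < g z.1)).
  apply: measurable_and.
    apply: measurable_fun_ler => //; exact: measurableT_comp mf measurable_fst.
  apply: measurable_fun_ltr => //; exact: measurableT_comp mg measurable_fst.
by rewrite -[X in measurable X]setTI; exact: (mfg _ [set true]).
Qed.

Lemma measurable_layer_set (f g : T -> R) (t : R) :
  measurable_fun setT f -> measurable_fun setT g ->
  measurable [set z | f z <= t < g z].
Proof.
move=> mf mg; have := measurable_ysection t (measurable_between mf mg).
by rewrite ysectionE.
Qed.

Lemma measurable_superlevel (g : T -> R) (t : R) :
  measurable_fun setT g -> measurable [set x | t < g x].
Proof.
move=> mg; rewrite -[X in measurable X]setTI -preimage_itvoy.
exact: mg.
Qed.

Lemma integral_between (a b : R) :
  (\int[leb]_t (\1_[set t | a <= t < b] t)%:E = (Num.max (b - a) 0)%:E)%E.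
Proof.
rewrite (_ : [set t | _] = `[a, b[%classic); last first.
  by apply/seteqP; split => t /=; rewrite in_itv.
rewrite integral_indic//= setIT lebesgue_measure_itv/= lte_fin -EFinB.
case: (ltP a b) => [ab|ba].
  by rewrite max_l ?subr_ge0 ?ltW//.
by rewrite max_r ?subr_le0//.
Qed.

Lemma measurable_layer (m : {sigma_finite_measure set T -> \bar R})
    (f g : T -> R) : measurable_fun setT f -> measurable_fun setT g ->
  measurable_fun [set: measurableTypeR R]
    (fun t => m [set z | f z <= t < g z]%R).
Proof.
move=> mf mg.
have := measurable_fun_ysection m (measurable_between mf mg).
apply: eq_measurable_fun => t _ /=; congr (m _).
by rewrite ysectionE.
Qed.

(** Tonelli for the region between the graphs of [f] and [g]: each vertical
    segment has length [max (g z - f z) 0]. *)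
Lemma layer_cake (m : {sigma_finite_measure set T -> \bar R}) (f g : T -> R) :
  measurable_fun setT f -> measurable_fun setT g ->
  (\int[m]_z (Num.max (g z - f z) 0)%:E =
   \int[leb]_t m [set z | f z <= t < g z]%R)%E.
Proof.
move=> mf mg; pose U := [set z : T * measurableTypeR R | f z.1 <= z.2 < g z.1].
have mU : measurable U by exact: measurable_between.
transitivity (\int[m]_z \int[leb]_t (\1_U (z, t))%:E)%E.
  by apply: eq_integral => z _; rewrite -integral_between.
have mfU : measurable_fun setT (EFin \o \1_U : _ -> \bar R).
  exact/measurable_EFinP.
rewrite (fubini_tonelli (EFin \o \1_U) mfU); last first.
  by move=> z; rewrite /= lee_fin.
apply: eq_integral => t _.
transitivity (\int[m]_z (\1_[set z | f z <= t < g z] z)%:E)%E => //.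
rewrite integral_indic ?setIT//.
exact: measurable_layer_set.
Qed.

End layer_cake.

Section coarea.
Context {R : realType} {d : measure_display} {S : measurableType d}.
Variables (q : R.-fker S ~> S) (mu : probability S R) (c : R).
Hypothesis c_ge0 : 0 <= c.
Hypothesis isoperimetry : forall A, measurable A -> (mu A <= (2^-1)%:E)%E ->
  (c%:E * mu A <= \int[mu]_(x in A) q x (~` A))%E.

(** Integrate the isoperimetric inequality for [{g > t}] over [t >= 0]; the edges
    from this set to its complement are those with [g y <= t < g x]. *)
Lemma coarea (g : S -> R) : measurable_fun setT g -> (forall x, 0 <= g x) ->
  (mu [set x | 0 < g x]%R <= (2^-1)%:E)%E ->
  (c%:E * \int[mu]_x (g x)%:E <=
   \int[edge_measure q mu]_z (Num.max (g z.1 - g z.2) 0)%:E)%E.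
Proof.
move=> mg g0 gsupp.
have m1 : measurable_fun setT (g \o @fst S S) by exact: measurableT_comp.
have m2 : measurable_fun setT (g \o @snd S S) by exact: measurableT_comp.
have m0 : measurable_fun setT (cst 0 : S -> R) by [].
rewrite (layer_cake _ m2 m1).
rewrite (eq_integral (fun x => (Num.max (g x - cst 0 x) 0)%:E)%E); last first.
  by move=> x _; rewrite subr0 max_l.
rewrite (layer_cake _ m0 mg) -ge0_integralZl//; last exact: measurable_layer.
apply: ge0_le_integral => //.
- by move=> t _; rewrite mule_ge0.
- by apply: measurable_funeM; exact: measurable_layer.
- exact: measurable_layer.
move=> t _.
(* Negative levels contribute nothing to the left-hand side, as [g >= 0]. *)
have [t0|t0] := ltP t 0.
  rewrite [X in (_ * mu X)%E](_ : _ = set0) ?measure0 ?mule0//.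
  by apply/seteqP; split => x //= /andP[]; rewrite leNgt t0.
rewrite [X in (_ * mu X)%E](_ : _ = [set x | t < g x]); last first.
  by apply/seteqP; split => x //= [/andP[]//|->]; rewrite t0.
have mA : measurable [set x | t < g x].
  exact: measurable_superlevel.
apply: le_trans (isoperimetry mA _) _.
  apply: le_trans gsupp; apply: le_measure; rewrite ?inE//.
    exact: measurable_superlevel.
  by move=> x /=; exact: le_lt_trans.
rewrite -edge_measureX//; last exact: measurableC.
apply: le_measure; rewrite ?inE//.
- by apply: measurableX => //; exact: measurableC.
- exact: measurable_layer_set.
- by move=> [x y] /= [tgx]; rewrite tgx andbT; move/negP; rewrite -leNgt => ->.
Qed.

End coarea.

(** * Medians *)

Section median.
Context {R : realType} {d : measure_display} {S : measurableType d}.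
Variable mu : probability S R.

Lemma measure_bigcup_nondecreasing_le (F : (set S)^nat) (a : \bar R) :
  (forall n, measurable (F n)) -> nondecreasing_seq F ->
  (forall n, mu (F n) <= a)%E -> (mu (\bigcup_n F n) <= a)%E.
Proof.
move=> mF ndF Fa.
have cF := nondecreasing_cvg_mu (mu := mu) mF (bigcupT_measurable F mF) ndF.
rewrite -(cvg_lim _ cF)//; apply: lime_le; last exact: nearW.
by apply/cvg_ex; exists (mu (\bigcup_n F n)).
Qed.

(** The infimum of the levels [t] with [mu {f > t} <= 1/2]: both bounds pass to
    the limit along increasing unions, from above and from below this level. *)
Lemma median_exists (f : S -> R) : measurable_fun setT f -> exists m : R,
  (mu [set x | m < f x]%R <= (2^-1)%:E)%E /\
  (mu [set x | f x < m]%R <= (2^-1)%:E)%E.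
Proof.
move=> mf.
have mgt t : measurable [set x | t < f x] by exact: measurable_superlevel.
have mle t : measurable [set x | f x <= t].
  rewrite (_ : [set x | _] = ~` [set x | t < f x]); first exact: measurableC.
  by apply/seteqP; split => x /=; rewrite leNgt => /negP.
have half1 : ~ (mu setT <= (2^-1)%:E)%E.
  apply/negP; rewrite probability_setT -ltNge lte_fin invf_lt1// ltr1n//.
have half_le t : ~ (mu [set x | t < f x]%R <= (2^-1)%:E)%E ->
    (mu [set x | f x <= t]%R <= (2^-1)%:E)%E.
  move/negP; rewrite -ltNge (_ : [set x | f x <= t] = ~` [set x | t < f x]).
    rewrite probability_setC//.
    have := fin_num_measure mu _ (mgt t).
    case: (mu _) => // r _; rewrite lte_fin -EFinB lee_fin => ?; lra.
  by apply/seteqP; split => x /=; rewrite leNgt => /negP.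
pose E := [set t | (mu [set x | t < f x]%R <= (2^-1)%:E)%E].
have E_up s t : E s -> s <= t -> E t.
  move=> Es st; apply: le_trans Es; apply: le_measure; rewrite ?inE//.
  by move=> x /=; exact: le_lt_trans.
have E0 : E !=set0.
  apply: contrapT => /forallNP nE; apply: half1.
  rewrite (_ : setT = \bigcup_n [set x | f x <= n%:R]).
    apply: measure_bigcup_nondecreasing_le => //.
      move=> m n mn; apply/subsetPset => x /= /le_trans; apply.
      by rewrite ler_nat.
    by move=> n; apply: half_le; exact: nE.
  apply/seteqP; split => x // _.
  by exists (Num.truncn `|f x|).+1 => //=; rewrite (le_trans (ler_norm _))// ltW// truncnS_gt.
have E_lb : has_lbound E.
  apply: contrapT => /forallNP nE; apply: half1.
  rewrite (_ : setT = \bigcup_n [set x | - n%:R < f x]).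
    apply: measure_bigcup_nondecreasing_le => //.
      move=> m n mn; apply/subsetPset => x /=; apply: le_lt_trans.
      by rewrite lerN2 ler_nat.
    move=> n; have /existsNP[t /not_implyP[Et /negP]] := nE (- n%:R).
    by rewrite -ltNge => /ltW; exact: E_up.
  apply/seteqP; split => x // _.
  exists (Num.truncn `|f x|).+1 => //=; rewrite ltrNl.
  by rewrite (le_lt_trans (ler_norm _))// normrN truncnS_gt.
exists (inf E); split.
- rewrite (_ : [set x | _] = \bigcup_n [set x | inf E + n.+1%:R^-1 < f x]).
    apply: measure_bigcup_nondecreasing_le => //.
      move=> m n mn; apply/subsetPset => x /=; apply: le_lt_trans.
      by rewrite lerD2l lef_pV2 ?posrE// ler_nat ltnS.
    move=> n; have n0 : 0 < n.+1%:R^-1 :> R by rewrite invr_gt0.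
    have [t Et tE] := inf_adherent n0 (conj E0 E_lb).
    exact: E_up Et (ltW tE).
  apply/seteqP; split => x /=.
    move=> Ex; have [n nE] := ltr_add_invr Ex.
    by exists n.
  by move=> [n _] /=; apply: lt_trans; rewrite ltrDl.
- rewrite (_ : [set x | _] = \bigcup_n [set x | f x <= inf E - n.+1%:R^-1]).
    apply: measure_bigcup_nondecreasing_le => //.
      move=> m n mn; apply/subsetPset => x /= /le_trans; apply.
      by rewrite lerD2l lerN2 lef_pV2 ?posrE// ler_nat ltnS.
    move=> n; apply: half_le => /(ge_inf E_lb).
    by rewrite leNgt gtrBl invr_gt0 ltr0Sn.
  apply/seteqP; split => x /=.
    move=> Ex; have [n nE] := ltr_add_invr Ex.
    by exists n => //=; rewrite lerBrDr ltW.
  by move=> [n _] /= /le_lt_trans; apply; rewrite gtrBl.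
Qed.

End median.

(** * Integrals of nonnegative real functions *)

Section ge0_real_integral.
Context {R : realType} {d : measure_display} {T : measurableType d}.
Variable nu : {measure set T -> \bar R}.
Implicit Types f g : T -> R.

Lemma ge0_integralD_real f g : measurable_fun setT f -> measurable_fun setT g ->
  (forall x, 0 <= f x) -> (forall x, 0 <= g x) ->
  (\int[nu]_x (f x + g x)%:E = \int[nu]_x (f x)%:E + \int[nu]_x (g x)%:E)%E.
Proof.
move=> mf mg f0 g0; rewrite -ge0_integralD//; try by apply/measurable_EFinP.
- by move=> x _; rewrite lee_fin.
- by move=> x _; rewrite lee_fin.
Qed.

Lemma ge0_integralZ_real (k : R) f : measurable_fun setT f -> 0 <= k ->
  (forall x, 0 <= f x) ->
  (\int[nu]_x (k * f x)%:E = k%:E * \int[nu]_x (f x)%:E)%E.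
Proof.
move=> mf k0 f0; rewrite -ge0_integralZl_EFin//; try exact/measurable_EFinP.
by move=> x _; rewrite lee_fin.
Qed.

Lemma ge0_le_integral_real f g : measurable_fun setT f -> measurable_fun setT g ->
  (forall x, 0 <= f x) -> (forall x, f x <= g x) ->
  (\int[nu]_x (f x)%:E <= \int[nu]_x (g x)%:E)%E.
Proof.
move=> mf mg f0 fg; apply: ge0_le_integral => //; try exact/measurable_EFinP.
- by move=> x _; rewrite lee_fin.
- by move=> x _; rewrite lee_fin.
Qed.

End ge0_real_integral.

(** Measurability and sign side conditions of the linearity of integrals. *)
Ltac side := repeat first
  [ done | progress intros | assumption
  | apply: measurable_funD | apply: measurable_funB | apply: measurable_funM
  | apply: measurable_funX
  | rewrite sqr_ge0 | apply: addr_ge0 | apply: mulr_ge0 | rewrite invr_ge0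
  | apply: ltW ].

(** * Cheeger's inequality for the Dirichlet energy *)

Section cheeger_lower.
Context {R : realType} {d : measure_display} {S : measurableType d}.
Variables (q : R.-fker S ~> S) (mu : probability S R) (M c : R).
Hypothesis q_le : forall x, (q x setT <= M%:E)%E.
Hypothesis inv : real_invariant q mu.
Hypothesis c_gt0 : 0 < c.
Hypothesis M_gt0 : 0 < M.
Hypothesis isoperimetry : forall A, measurable A -> (mu A <= (2^-1)%:E)%E ->
  (c%:E * mu A <= \int[mu]_(x in A) q x (~` A))%E.

Let Q := edge_measure q mu.

Definition dirichlet_energy (g : S -> R) : \bar R :=
  (\int[Q]_z ((g z.1 - g z.2) ^+ 2)%:E)%E.

(** [|a^2 - b^2| <= (a - b)^2 / (2 eta) + eta (a + b)^2 / 2], with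
    [(a + b)^2 <= 2 (a^2 + b^2)], halved and rearranged so that every
    term is nonnegative: the terms in [b^2 / 2] and [a^2 / 2] integrate to
    the same value by balance and then cancel. *)
Lemma amgm_sq_diff (eta a b : R) : 0 < eta ->
  Num.max (a ^+ 2 - b ^+ 2) 0 + b ^+ 2 / 2 <=
  (a - b) ^+ 2 / (4 * eta) + eta / 2 * (a ^+ 2 + b ^+ 2) + a ^+ 2 / 2.
Proof.
move=> eta0.
have H : `|a ^+ 2 - b ^+ 2| / 2 <=
    (a - b) ^+ 2 / (4 * eta) + eta / 2 * (a ^+ 2 + b ^+ 2).
  have K : `|(a - b) * (a + b)| <= (a - b) ^+ 2 / (2 * eta) + eta / 2 * (a + b) ^+ 2.
    rewrite ler_norml; apply/andP; split; rewrite -subr_ge0.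
      have -> : (a - b) * (a + b) - - ((a - b) ^+ 2 / (2 * eta) + eta / 2 * (a + b) ^+ 2)
        = ((a - b) + eta * (a + b)) ^+ 2 / (2 * eta) by field; rewrite gt_eqF.
      by rewrite divr_ge0 ?sqr_ge0// mulr_ge0// ltW.
    have -> : ((a - b) ^+ 2 / (2 * eta) + eta / 2 * (a + b) ^+ 2) - (a - b) * (a + b)
        = ((a - b) - eta * (a + b)) ^+ 2 / (2 * eta) by field; rewrite gt_eqF.
    by rewrite divr_ge0 ?sqr_ge0// mulr_ge0// ltW.
  rewrite subr_sqr; apply: (@le_trans _ _
    (((a - b) ^+ 2 / (2 * eta) + eta / 2 * (a + b) ^+ 2) / 2)).
    by rewrite ler_pM2r ?invr_gt0.
  have -> : ((a - b) ^+ 2 / (2 * eta) + eta / 2 * (a + b) ^+ 2) / 2 =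
     (a - b) ^+ 2 / (4 * eta) + eta / 4 * (a + b) ^+ 2 by field; rewrite gt_eqF.
  rewrite lerD2l.
  have : 0 <= eta * (a - b) ^+ 2 by rewrite mulr_ge0 ?sqr_ge0// ltW.
  nra.
case: (leP (b ^+ 2) (a ^+ 2)) => ba.
  rewrite max_l ?subr_ge0//.
  move: H; rewrite ger0_norm ?subr_ge0// => H; lra.
move/ltW in ba; rewrite max_r ?subr_le0//.
move: H; rewrite ler0_norm ?subr_le0// => H; lra.
Qed.

(** Coarea for [g^2] followed by [amgm_sq_diff], with [eta = c / (2 M)]: the term in
    [eta] is then at most half of [c * int g^2]. *)
Lemma dirichlet_half (g : S -> R) : measurable_fun setT g ->
  (forall x, 0 <= g x) -> (mu [set x | 0 < g x]%R <= (2^-1)%:E)%E ->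
  (\int[mu]_x (g x ^+ 2)%:E < +oo)%E ->
  ((c ^+ 2 / M)%:E * \int[mu]_x (g x ^+ 2)%:E <= dirichlet_energy g)%E.
Proof.
move=> mg g0 gsupp goo.
have mg2 : measurable_fun setT (fun x => g x ^+ 2).
  exact: measurable_funX.
have g2supp : (mu [set x | 0 < g x ^+ 2]%R <= (2^-1)%:E)%E.
  apply: le_trans gsupp; apply: le_measure; rewrite ?inE//.
  - exact: measurable_superlevel.
  - exact: measurable_superlevel.
  - move=> x /=; rewrite lt0r expf_eq0/= => /andP[gx _].
    by rewrite lt0r gx g0.
have := coarea (ltW c_gt0) isoperimetry mg2 (fun x => sqr_ge0 (g x)) g2supp.
set G := (\int[mu]_x _)%E; set P := (\int[_]_z _)%E => GP.
set D := dirichlet_energy g.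
pose B := (\int[Q]_z (g z.1 ^+ 2)%:E)%E.
have me2 : measurable_fun setT (fun x => (g x ^+ 2)%:E) by exact/measurable_EFinP.
have ge2 x : (0 <= (g x ^+ 2)%:E)%E by rewrite lee_fin sqr_ge0.
have BM : (B <= M%:E * G)%E.
  exact: (edge_measure_fst_le _ q_le me2 ge2).
have B2 : (\int[Q]_z (g z.2 ^+ 2)%:E = B)%E.
  exact: (edge_measure_balance q_le inv me2 ge2).
have m1 : measurable_fun setT (g \o @fst S S) by exact: measurableT_comp.
have m2 : measurable_fun setT (g \o @snd S S) by exact: measurableT_comp.
have eta0 : 0 < c / (2 * M) by rewrite divr_gt0// mulr_gt0.
pose pz (z : S * S) := Num.max (g z.1 ^+ 2 - g z.2 ^+ 2) 0.
pose az (z : S * S) := g z.1 ^+ 2.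
pose bz (z : S * S) := g z.2 ^+ 2.
pose dz (z : S * S) := (g z.1 - g z.2) ^+ 2.
have mpz : measurable_fun setT pz.
  by apply: measurable_maxr => //; apply: measurable_funB; exact: measurable_funX.
have maz : measurable_fun setT az by exact: measurable_funX.
have mbz : measurable_fun setT bz by exact: measurable_funX.
have mdz : measurable_fun setT dz.
  by apply: measurable_funX; exact: measurable_funB.
have pz0 z : 0 <= pz z by rewrite le_max lexx orbT.
have az0 z : 0 <= az z by rewrite sqr_ge0.
have bz0 z : 0 <= bz z by rewrite sqr_ge0.
have dz0 z : 0 <= dz z by rewrite sqr_ge0.
have key : (P + (2^-1)%:E * B <=
   (M / (2 * c))%:E * D + ((c / (4 * M))%:E * (B + B) + (2^-1)%:E * B))%E.
  rewrite -{1}B2.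
  have -> : (P + (2^-1)%:E * \int[Q]_z (g z.2 ^+ 2)%:E =
      \int[Q]_z (pz z + 2^-1 * bz z)%:E)%E.
    by rewrite ge0_integralD_real ?ge0_integralZ_real; side.
  have -> : ((M / (2 * c))%:E * D + ((c / (4 * M))%:E * (B + B) + (2^-1)%:E * B) =
      \int[Q]_z (M / (2 * c) * dz z + (c / (4 * M) * (az z + bz z) + 2^-1 * az z))%:E)%E.
    do 2 (rewrite ge0_integralD_real; try by side).
    do 3 (rewrite ge0_integralZ_real; try by side).
    by rewrite ge0_integralD_real ?B2; side.
  apply: ge0_le_integral_real; try by side.
  move=> z; have := amgm_sq_diff (g z.1) (g z.2) eta0.
  have -> : (g z.1 - g z.2) ^+ 2 / (4 * (c / (2 * M))) = M / (2 * c) * dz z.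
    by rewrite /dz; field; rewrite !gt_eqF.
  have -> : c / (2 * M) / 2 = c / (4 * M) by field; rewrite gt_eqF.
  rewrite /pz /az /bz; lra.
have G0 : (0 <= G)%E by exact: integral_ge0.
have B0 : (0 <= B)%E by apply: integral_ge0 => z _; rewrite lee_fin sqr_ge0.
have Boo : (B < +oo)%E.
  by rewrite (le_lt_trans BM)// lte_mul_pinfty// lee_fin ltW.
have P0 : (0 <= P)%E by apply: integral_ge0 => z _; rewrite lee_fin pz0.
have D0 : (0 <= D)%E by apply: integral_ge0 => z _; rewrite lee_fin dz0.
clear B2; move: key GP BM; rewrite -/D.
case: D D0 => [D1||] D0 //; last by rewrite leey.
have {}goo : (G < +oo)%E := goo.
case: G G0 goo => [G1||]// G0; rewrite ?ltxx// => _.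
case: B B0 Boo => [B1||]// B0; rewrite ?ltxx// => _.
case: P P0 => [P1||]// P0; rewrite ?lee_fin.
move=> key GP BM.
have E1 : c / (4 * M) * (B1 + B1) <= c / 2 * G1.
  have -> : c / (4 * M) * (B1 + B1) = c / (2 * M) * B1 by field; rewrite gt_eqF.
  have -> : c / 2 * G1 = c / (2 * M) * (M * G1) by field; rewrite gt_eqF.
  by rewrite ler_pM2l.
have E2 : c / 2 * G1 <= M / (2 * c) * D1 by lra.
have -> : c ^+ 2 / M * G1 = (2 * c / M) * (c / 2 * G1) by field; rewrite gt_eqF.
have -> : D1 = (2 * c / M) * (M / (2 * c) * D1) by field; rewrite !gt_eqF.
by rewrite ler_pM2l// divr_gt0// mulr_gt0.
Qed.

End cheeger_lower.

Section poincare.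
Context {R : realType} {d : measure_display} {S : measurableType d}.
Variables (q : R.-fker S ~> S) (mu : probability S R) (M c : R).
Hypothesis q_le : forall x, (q x setT <= M%:E)%E.
Hypothesis inv : real_invariant q mu.
Hypothesis c_gt0 : 0 < c.
Hypothesis M_gt0 : 0 < M.
Hypothesis isoperimetry : forall A, measurable A -> (mu A <= (2^-1)%:E)%E ->
  (c%:E * mu A <= \int[mu]_(x in A) q x (~` A))%E.

Lemma sqr_integrable (nu : {measure set S -> \bar R}) (f : S -> R) :
  measurable_fun setT f -> (\int[nu]_x (f x ^+ 2)%:E < +oo)%E ->
  nu.-integrable setT (EFin \o (fun x => f x ^+ 2)).
Proof.
move=> mf foo; apply/integrableP; split.
  by apply/measurable_EFinP; exact: measurable_funX.
by under eq_integral do rewrite /= ger0_norm ?sqr_ge0//.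
Qed.

Lemma sqr_integrable1 (nu : {measure set S -> \bar R}) (f : S -> R) :
  (nu setT < +oo)%E ->
  measurable_fun setT f -> (\int[nu]_x (f x ^+ 2)%:E < +oo)%E ->
  nu.-integrable setT (EFin \o f).
Proof.
move=> nuoo mf foo.
have i1 : nu.-integrable setT (EFin \o (fun x => 1 + f x ^+ 2)).
  have i0 : nu.-integrable setT (EFin \o cst 1).
    by apply: integrable_sup_bounded => //; exists 1 => x; rewrite normr1.
  by apply: eq_integrable (integrableD measurableT i0 (sqr_integrable mf foo)).
apply: le_integrable i1 => //; first exact/measurable_EFinP.
move=> x _; rewrite lee_fin (ger0_norm (addr_ge0 _ (sqr_ge0 _)))//.
have := sqr_ge0 (f x - 2^-1); have := sqr_ge0 (f x + 2^-1).
by case: (ler0P (f x)) => _; nra.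
Qed.

(** The cross term is favourable: the positive and the negative part of [a - m]
    cannot move in the same direction. *)
Lemma dirichlet_split (a b m : R) :
  (Num.max (a - m) 0 - Num.max (b - m) 0) ^+ 2 +
  (Num.max (m - a) 0 - Num.max (m - b) 0) ^+ 2 <= (a - b) ^+ 2.
Proof.
have split2 (x : R) : x <= m /\ Num.max (x - m) 0 = 0 /\ Num.max (m - x) 0 = m - x \/
   m <= x /\ Num.max (x - m) 0 = x - m /\ Num.max (m - x) 0 = 0.
  have [xm|mx] := leP x m; [left|right]; repeat split => //.
  - by rewrite max_r ?subr_le0.
  - by rewrite max_l ?subr_ge0.
  - exact: ltW.
  - by rewrite max_l ?subr_ge0 ?ltW.
  - by rewrite max_r ?subr_le0 ?ltW.
by case: (split2 a) => -[am [-> ->]]; case: (split2 b) => -[bm [-> ->]]; nra.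
Qed.

Lemma sqr_max_split (a m : R) :
  Num.max (a - m) 0 ^+ 2 + Num.max (m - a) 0 ^+ 2 = (a - m) ^+ 2.
Proof.
have [am|ma] := leP a m.
  by rewrite max_r ?subr_le0// max_l ?subr_ge0//; ring.
by rewrite max_l ?subr_ge0 ?ltW// max_r ?subr_le0 ?ltW//; ring.
Qed.

(** Apply [dirichlet_half] to both parts of [f - m], [m] a median; passing from
    [f] to [f - m] only increases the second moment, as [f] has mean zero. *)
Lemma dirichlet_poincare (f : S -> R) : measurable_fun setT f ->
  (\int[mu]_x (f x ^+ 2)%:E < +oo)%E -> \int[mu]_x f x = 0 ->
  ((c ^+ 2 / M)%:E * \int[mu]_x (f x ^+ 2)%:E <= dirichlet_energy q mu f)%E.
Proof.
move=> mf foo f0.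
have [m [mgt mlt]] := median_exists mu mf.
pose g x := Num.max (f x - m) 0; pose h x := Num.max (m - f x) 0.
have mg : measurable_fun setT g by apply: measurable_maxr => //; exact: measurable_funB.
have mh : measurable_fun setT h by apply: measurable_maxr => //; exact: measurable_funB.
have g0 x : 0 <= g x by rewrite le_max lexx orbT.
have h0 x : 0 <= h x by rewrite le_max lexx orbT.
have muoo : (mu setT < +oo)%E by rewrite probability_setT ltry.
have i2 := sqr_integrable mf foo.
have i1 := sqr_integrable1 muoo mf foo.
have GH : (\int[mu]_x (g x ^+ 2)%:E + \int[mu]_x (h x ^+ 2)%:E =
    \int[mu]_x (f x ^+ 2)%:E + (m ^+ 2)%:E)%E.
  rewrite -ge0_integralD_real; try by side.
  under eq_integral do rewrite sqr_max_split.
  have ic (k : R) : mu.-integrable setT (EFin \o (fun _ : S => k)).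
    by apply: integrable_sup_bounded => //; exists `|k|.
  have ik : mu.-integrable setT (EFin \o (fun x => (2 * m) * f x)).
    by apply: eq_integrable (integrableZl measurableT (2 * m) i1) => //.
  transitivity (\int[mu]_x (f x ^+ 2 - (2 * m) * f x + m ^+ 2)%:E)%E.
    by apply: eq_integral => x _; congr EFin; ring.
  have iB := integrableB measurableT i2 ik.
  rewrite (integralD_EFin measurableT iB (ic _)).
  rewrite (integralB_EFin measurableT i2 ik).
  rewrite [X in (_ + X)%E = _](_ : _ = (m ^+ 2)%:E)%E; last first.
    apply: etrans (@integral_cst _ _ _ mu setT measurableT (m ^+ 2)%:E) _.
    by rewrite -[RHS]mule1; congr (_ * _)%E; exact: probability_setT.
  have -> : (\int[mu]_x (2 * m * f x)%:E = 0)%E.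
    rewrite -[LHS]fineK ?(integrable_fin_num _ ik)//.
    by rewrite -[fine _]/(Rintegral mu setT (fun x => 2 * m * f x)) RintegralZl// f0 mulr0.
  by rewrite sube0.
have FGH : (\int[mu]_x (f x ^+ 2)%:E <=
    \int[mu]_x (g x ^+ 2)%:E + \int[mu]_x (h x ^+ 2)%:E)%E.
  by rewrite GH leeDl// lee_fin sqr_ge0.
have GHoo : (\int[mu]_x (g x ^+ 2)%:E + \int[mu]_x (h x ^+ 2)%:E < +oo)%E.
  by rewrite GH lte_add_pinfty// ltry.
have pos (k : S -> R) : (0 <= \int[mu]_x (k x ^+ 2)%:E)%E.
  by apply: integral_ge0 => x _; rewrite lee_fin sqr_ge0.
have goo : (\int[mu]_x (g x ^+ 2)%:E < +oo)%E by apply: le_lt_trans GHoo; rewrite leeDl.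
have hoo : (\int[mu]_x (h x ^+ 2)%:E < +oo)%E by apply: le_lt_trans GHoo; rewrite leeDr.
have gsupp : (mu [set x | 0 < g x]%R <= (2^-1)%:E)%E.
  rewrite (_ : [set x | _] = [set x | m < f x])//.
  by apply/seteqP; split => x /=; rewrite lt_max subr_gt0 ltxx orbF.
have hsupp : (mu [set x | 0 < h x]%R <= (2^-1)%:E)%E.
  rewrite (_ : [set x | _] = [set x | f x < m])//.
  by apply/seteqP; split => x /=; rewrite lt_max subr_gt0 ltxx orbF.
have Dg := dirichlet_half q_le inv c_gt0 M_gt0 isoperimetry mg g0 gsupp goo.
have Dh := dirichlet_half q_le inv c_gt0 M_gt0 isoperimetry mh h0 hsupp hoo.
have k0 : 0 <= c ^+ 2 / M by rewrite divr_ge0 ?sqr_ge0// ltW.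
apply: (@le_trans _ _ ((c ^+ 2 / M)%:E *
    (\int[mu]_x (g x ^+ 2)%:E + \int[mu]_x (h x ^+ 2)%:E))%E).
  by rewrite lee_wpmul2l.
rewrite ge0_muleDr//; apply: le_trans (leeD Dg Dh) _.
have m1 (k : S -> R) : measurable_fun setT k ->
    measurable_fun setT (k \o @fst S S) by move=> mk; exact: measurableT_comp.
have m2 (k : S -> R) : measurable_fun setT k ->
    measurable_fun setT (k \o @snd S S) by move=> mk; exact: measurableT_comp.
have md (k : S -> R) : measurable_fun setT k ->
    measurable_fun setT (fun z : S * S => (k z.1 - k z.2) ^+ 2).
  by move=> mk; apply: measurable_funX; apply: measurable_funB; [exact: m1|exact: m2].
have mdf := md f mf; have mdg := md g mg; have mdh := md h mh.
rewrite /dirichlet_energy -ge0_integralD_real; try by side.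
apply: ge0_le_integral_real; try by side.
by move=> z; exact: dirichlet_split.
Qed.

End poincare.

(** * Lower bound on the generator *)

Section generator_lower.
Context {R : realType} {d : measure_display} {S : measurableType d}.
Variable q : R.-fker S ~> S.

Lemma measurable_real_generator (u : S -> R) : measurable_fun setT u ->
  measurable_fun setT (real_generator q u).
Proof.
move=> mu; apply: measurableT_comp => //=.
pose k (z : S * S) := (u z.2 - u z.1)%:E.
have mk : measurable_fun setT k.
  by apply/measurable_EFinP; apply: measurable_funB; exact: measurableT_comp.
rewrite [X in measurable_fun _ X](_ : _ =
    fun x => ((\int[q x]_y k^\+ (x, y)) - (\int[q x]_y k^\- (x, y)))%E).
  apply: emeasurable_funB.
    apply: (measurable_fun_integral_finite_kernel k^\+%E) => //.
    exact: measurable_funepos.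
  apply: (measurable_fun_integral_finite_kernel k^\-%E) => //.
  exact: measurable_funeneg.
apply/funext => x; rewrite [LHS]integralE.
by congr (_ - _)%E; apply: eq_integral => y _; rewrite ?funeposE ?funenegE.
Qed.

Hypothesis q_fin : forall x, (q x setT < +oo)%E.

(** Both sides differ by [(kappa u + L u)^2 / kappa], from the identity
    [2 u L u = L (u^2) - int (u x - u y)^2 q(x, dy)]. Written with nonnegative terms
    only, it also holds where [u] is not square integrable for [q x]. *)
Lemma carre_du_champ_bound (u : S -> R) (kappa : R) (x : S) :
  measurable_fun setT u -> 0 < kappa ->
  (\int[q x]_y ((u x - u y) ^+ 2)%:E + (u x ^+ 2)%:E * q x setT <=
   (kappa * u x ^+ 2 + kappa^-1 * real_generator q u x ^+ 2)%:E +
   \int[q x]_y (u y ^+ 2)%:E)%E.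
Proof.
move=> mu kappa0.
have rhs0 : 0 <= kappa * u x ^+ 2 + kappa^-1 * real_generator q u x ^+ 2.
  by rewrite addr_ge0// mulr_ge0 ?sqr_ge0 ?invr_ge0// ltW.
have [Uoo|Uoo] := ltP (\int[q x]_y (u y ^+ 2)%:E)%E +oo%E; last first.
  by move: Uoo; rewrite leye_eq => /eqP ->; rewrite addey// leey.
have i2 := sqr_integrable mu Uoo.
have i1 := sqr_integrable1 (q_fin x) mu Uoo.
have ic (k : R) : (q x).-integrable setT (EFin \o (fun _ : S => k)).
  by apply: integrable_sup_bounded => //; exists `|k|.
have ik : (q x).-integrable setT (EFin \o (fun y => (2 * u x) * u y)).
  by apply: eq_integrable (integrableZl measurableT (2 * u x) i1) => //.
have E : (\int[q x]_y ((u x - u y) ^+ 2)%:E =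
    (\int[q x]_y (u y ^+ 2) - 2 * u x * \int[q x]_y u y + u x ^+ 2 * fine (q x setT))%:E)%E.
  transitivity (\int[q x]_y (u y ^+ 2 - (2 * u x) * u y + u x ^+ 2)%:E)%E.
    by apply: eq_integral => y _; congr EFin; ring.
  have iB := integrableB measurableT i2 ik.
  have iBC := integrableD measurableT iB (ic (u x ^+ 2)).
  rewrite -[LHS]fineK ?(integrable_fin_num _ iBC)//; congr EFin.
  rewrite -[LHS]/(Rintegral (q x) setT (fun y => u y ^+ 2 - 2 * u x * u y + u x ^+ 2)).
  by rewrite RintegralD// RintegralB// RintegralZl// Rintegral_cst.
have qE : q x setT = (fine (q x setT))%:E by rewrite fineK// ge0_fin_numE.
have -> : (\int[q x]_y (u y ^+ 2)%:E = (\int[q x]_y (u y ^+ 2))%:E)%E.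
  by rewrite fineK// (integrable_fin_num _ i2).
rewrite E [X in (_ + _ * X <= _)%E]qE -EFinM -!EFinD lee_fin real_generatorE//.
set n := fine (q x setT); set U1 := \int[q x]_y u y; set U2 := \int[q x]_y (u y ^+ 2).
set L := U1 - u x * n.
have : 0 <= kappa^-1 * (kappa * u x + L) ^+ 2.
  by rewrite mulr_ge0 ?sqr_ge0// invr_ge0 ltW.
have -> : kappa^-1 * (kappa * u x + L) ^+ 2 = kappa * u x ^+ 2 + 2 * u x * L + kappa^-1 * L ^+ 2.
  by field; rewrite gt_eqF.
rewrite /L; lra.
Qed.

End generator_lower.

Section cheeger_lower_real.
Context {R : realType} {d : measure_display} {S : measurableType d}.
Variables (q : R.-fker S ~> S) (mu : probability S R) (M c : R).
Hypothesis q_le : forall x, (q x setT <= M%:E)%E.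
Hypothesis inv : real_invariant q mu.
Hypothesis c_gt0 : 0 < c.
Hypothesis M_gt0 : 0 < M.
Hypothesis isoperimetry : forall A, measurable A -> (mu A <= (2^-1)%:E)%E ->
  (c%:E * mu A <= \int[mu]_(x in A) q x (~` A))%E.

(** Integrating [carre_du_champ_bound] against [mu], the terms [u x ^+ 2 * q x setT]
    and [int u(y)^2 q(x, dy)] cancel by balance. This is [- <u, L u> <= |u| |L u|] in
    the form of an arithmetic-geometric mean inequality, which avoids integrating
    functions of both signs. *)
Lemma real_generator_lower (u : S -> R) : measurable_fun setT u ->
  (\int[mu]_x (u x ^+ 2)%:E < +oo)%E -> \int[mu]_x u x = 0 ->
  (((c ^+ 2 / (2 * M)) ^+ 2)%:E * \int[mu]_x (u x ^+ 2)%:E <=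
   \int[mu]_x (real_generator q u x ^+ 2)%:E)%E.
Proof.
move=> mu' uoo u0; set kappa := c ^+ 2 / (2 * M).
have kappa0 : 0 < kappa by rewrite divr_gt0 ?exprn_gt0// mulr_gt0.
have := dirichlet_poincare q_le inv c_gt0 M_gt0 isoperimetry mu' uoo u0.
have mL := measurable_real_generator q mu'.
set F := (\int[mu]_x (u x ^+ 2)%:E)%E; set D := dirichlet_energy q mu u.
set L := (\int[mu]_x (real_generator q u x ^+ 2)%:E)%E.
have mu2 : measurable_fun setT (fun x => (u x ^+ 2)%:E).
  by apply/measurable_EFinP; exact: measurable_funX.
have u2 x : (0 <= (u x ^+ 2)%:E)%E by rewrite lee_fin sqr_ge0.
pose B := (\int[mu]_x ((u x ^+ 2)%:E * q x setT))%E.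
have BE : (\int[edge_measure q mu]_z (u z.1 ^+ 2)%:E = B)%E.
  exact: (edge_measure_fst q mu mu2 u2).
have BM : (B <= M%:E * F)%E.
  by rewrite -BE; exact: (edge_measure_fst_le _ q_le mu2 u2).
have B2 : (\int[mu]_x \int[q x]_y (u y ^+ 2)%:E = B)%E.
  rewrite -BE -(edge_measure_balance q_le inv mu2 u2) integral_edge_measure//.
  exact: measurableT_comp mu2 measurable_snd.
have md : measurable_fun setT (fun z : S * S => ((u z.1 - u z.2) ^+ 2)%:E).
  apply/measurable_EFinP; apply: measurable_funX.
  by apply: measurable_funB; exact: measurableT_comp.
have d0 (z : S * S) : (0 <= ((u z.1 - u z.2) ^+ 2)%:E)%E by rewrite lee_fin sqr_ge0.
pose dx x := (\int[q x]_y ((u x - u y) ^+ 2)%:E)%E.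
pose ux x := (\int[q x]_y (u y ^+ 2)%:E)%E.
pose bx x := ((u x ^+ 2)%:E * q x setT)%E.
pose cx x := kappa * u x ^+ 2 + kappa^-1 * real_generator q u x ^+ 2.
have dx0 x : (0 <= dx x)%E by apply: integral_ge0 => y _; rewrite lee_fin sqr_ge0.
have ux0 x : (0 <= ux x)%E by exact: integral_ge0.
have bx0 x : (0 <= bx x)%E by rewrite mule_ge0.
have cx0 x : 0 <= cx x by rewrite /cx; side.
have mdx : measurable_fun setT dx.
  exact: (measurable_fun_integral_finite_kernel (fun z => ((u z.1 - u z.2) ^+ 2)%:E)%E).
have mux : measurable_fun setT ux.
  apply: (measurable_fun_integral_finite_kernel (fun z => (u z.2 ^+ 2)%:E)%E) => //.
  exact: measurableT_comp mu2 measurable_snd.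
have mbx : measurable_fun setT bx.
  by apply: emeasurable_funM => //; exact: measurable_kernel.
have mcx : measurable_fun setT cx by rewrite /cx; side.
have mcx' : measurable_fun setT (fun x => (cx x)%:E) by exact/measurable_EFinP.
have key : (D + B <= (kappa%:E * F + kappa^-1%:E * L) + B)%E.
  have -> : (D + B = \int[mu]_x (dx x + bx x))%E.
    by rewrite ge0_integralD// /D /dirichlet_energy integral_edge_measure.
  have -> : (kappa%:E * F + kappa^-1%:E * L + B = \int[mu]_x ((cx x)%:E + ux x))%E.
    rewrite ge0_integralD//; last by move=> x _; rewrite lee_fin.
    rewrite B2; congr (_ + _)%E.
    by rewrite ge0_integralD_real ?ge0_integralZ_real; side.
  apply: ge0_le_integral => //.
  - by move=> x _; rewrite adde_ge0.
  - exact: emeasurable_funD.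
  - exact: emeasurable_funD.
  - by move=> x _; apply: carre_du_champ_bound => // x'; rewrite (le_lt_trans (q_le x'))// ltry.
have F0 : (0 <= F)%E by exact: integral_ge0.
have Foo : (F < +oo)%E := uoo.
have B0 : (0 <= B)%E by apply: integral_ge0 => x _; exact: bx0.
have Boo : (B < +oo)%E.
  by rewrite (le_lt_trans BM)// lte_mul_pinfty// lee_fin ltW.
have L0 : (0 <= L)%E by apply: integral_ge0 => z _; rewrite lee_fin sqr_ge0.
clear B2 BE; move: key.
case: F F0 Foo BM => [F1||]// F0; rewrite ?ltxx// => _ _.
case: B B0 Boo => [B1||]// B0; rewrite ?ltxx// => _.
case: L L0 => [L1||]// L0; last by rewrite leey.
rewrite leeD2rE// => key DF; move: (le_trans DF key).
rewrite -!EFinM -EFinD !lee_fin => H.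
have E1 : c ^+ 2 / M * F1 = 2 * kappa * F1 by rewrite /kappa; field; rewrite gt_eqF.
have E2 : kappa * F1 <= kappa^-1 * L1 by lra.
have -> : kappa ^+ 2 * F1 = kappa * (kappa * F1) by ring.
by rewrite -ler_pdivlMl// .
Qed.

End cheeger_lower_real.

(** * The resolvent of a bounded generator *)

Section resolvent.
Context {R : realType} {d : measure_display} {S : measurableType d}.
Variables (q : R.-fker S ~> S) (M lam : R) (A : set S).
Hypothesis q_le : forall x, (q x setT <= M%:E)%E.
Hypotheses (M_gt0 : 0 < M) (lam_gt0 : 0 < lam) (mA : measurable A).

Let n x := fine (q x setT).

Let q_lty x : (q x setT < +oo)%E.
Proof. by rewrite (le_lt_trans (q_le x)) ?ltry. Qed.

Let n_ge0 x : 0 <= n x. Proof. exact: fine_ge0. Qed.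

Let n_le x : n x <= M.
Proof. by rewrite -lee_fin /n fineK// ge0_fin_numE. Qed.

Let measurable_n : measurable_fun setT n.
Proof. by apply: measurableT_comp => //; exact: measurable_kernel. Qed.

(** [(lam - L) v = lam 1_A] reads [v = resolvent_step v], the constant [M] being
    added on both sides to make the right-hand side monotone in [v]. *)
Definition resolvent_step (v : S -> R) (x : S) : R :=
  (lam * \1_A x + (M - n x) * v x + \int[q x]_y v y) / (lam + M).

Definition resolvent_iter (k : nat) : S -> R := iter k resolvent_step (cst 0).

Let unit_valued (v : S -> R) :=
  measurable_fun setT v /\ forall x, 0 <= v x <= 1.

Let unit_valued_integrable v x : unit_valued v ->
  (q x).-integrable setT (EFin \o v).
Proof.
move=> [mv v01]; apply: integrable_sup_bounded => //.
by exists 1 => y; have /andP[v0 v1] := v01 y; rewrite ger0_norm.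
Qed.

Let lamM_gt0 : 0 < lam + M. Proof. exact: addr_gt0. Qed.

Let unit_valued_step v : unit_valued v -> unit_valued (resolvent_step v).
Proof.
move=> uv; have [mv v01] := uv; split.
  apply: measurable_funM => //; apply: measurable_funD.
    apply: measurable_funD; apply: measurable_funM => //.
    exact: measurable_funB.
  apply: measurableT_comp => //.
  apply: measurable_fun_integral_kernel.
  - by move=> U mU; exact: measurable_kernel.
  - by move=> z; rewrite lee_fin; case/andP: (v01 z).
  - exact/measurable_EFinP.
move=> x; have /andP[v0 v1] := v01 x.
have I0 : 0 <= \int[q x]_y v y.
  by apply: Rintegral_ge0 => y _; case/andP: (v01 y).
have I1 : \int[q x]_y v y <= n x.
  rewrite -[leRHS]mul1r -Rintegral_cst//; apply: le_Rintegral => //.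
  - exact: unit_valued_integrable.
  - by apply: integrable_sup_bounded => //; exists 1 => y; rewrite normr1.
  - by move=> y _; case/andP: (v01 y).
have A01 : 0 <= (\1_A x : R) <= 1 by rewrite indicE; case: (x \in A); rewrite ?lexx ?ler01.
have := n_le x; have := n_ge0 x => n0 nM.
rewrite /resolvent_step divr_ge0 ?ler_pdivrMr ?mul1r//=.
- case/andP: A01 => A0 A1.
  have : 0 <= lam * (1 - \1_A x) by rewrite mulr_ge0 ?subr_ge0// ltW.
  have : 0 <= (M - n x) * (1 - v x) by rewrite mulr_ge0 ?subr_ge0.
  lra.
- by case/andP: A01 => A0 A1; rewrite !addr_ge0// mulr_ge0 ?subr_ge0// ltW.
- exact: ltW.
Qed.

Let step_homo v w : unit_valued v -> unit_valued w ->
  (forall x, v x <= w x) -> forall x, resolvent_step v x <= resolvent_step w x.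
Proof.
move=> uv uw vw x; rewrite /resolvent_step ler_pM2r ?invr_gt0//.
apply: lerD; first by rewrite lerD2l ler_wpM2l ?subr_ge0.
by apply: le_Rintegral => //; exact: unit_valued_integrable.
Qed.

Let unit_valued_iter k : unit_valued (resolvent_iter k).
Proof.
elim: k => [|k IH]; last exact: unit_valued_step.
by split => // x; rewrite lexx ler01.
Qed.

Let iter_nondecreasing x : nondecreasing_seq (resolvent_iter ^~ x).
Proof.
apply/nondecreasing_seqP => k; elim: k x => [|k IH] x.
  by case: (unit_valued_iter 1) => _ /(_ x) /andP[].
exact: (step_homo (unit_valued_iter k) (unit_valued_iter k.+1) IH).
Qed.

Let iter_cvg x : cvgn (resolvent_iter ^~ x).
Proof.
apply: nondecreasing_is_cvgn => //; exists 1 => _ [k _ <-].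
by case: (unit_valued_iter k) => _ /(_ x) /andP[].
Qed.

Definition resolvent (x : S) : R := limn (resolvent_iter ^~ x).

Lemma measurable_resolvent : measurable_fun setT resolvent.
Proof.
apply: (measurable_fun_cvg (h := resolvent_iter)).
  by move=> k; case: (unit_valued_iter k).
by move=> x _; exact: iter_cvg.
Qed.

Lemma resolvent_ge0 x : 0 <= resolvent x.
Proof.
apply: limr_ge => //; apply: nearW => k.
by case: (unit_valued_iter k) => _ /(_ x) /andP[].
Qed.

Lemma resolvent_le1 x : resolvent x <= 1.
Proof.
apply: limr_le => //; apply: nearW => k.
by case: (unit_valued_iter k) => _ /(_ x) /andP[].
Qed.

Let unit_valued_resolvent : unit_valued resolvent.
Proof.
by split; [exact: measurable_resolvent|move=> x; rewrite resolvent_ge0 resolvent_le1].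
Qed.

(** The iterates increase to [resolvent], so monotone convergence makes it a fixed
    point. *)
Lemma resolventE x :
  lam * (resolvent x - \1_A x) = real_generator q resolvent x.
Proof.
have ir := unit_valued_integrable x unit_valued_resolvent.
have cI : (\int[q x]_y resolvent_iter k y) @[k --> \oo] --> \int[q x]_y resolvent y.
  apply: fine_cvg; rewrite fineK ?(integrable_fin_num _ ir)//.
  rewrite (_ : (\int[q x]_y (resolvent y)%:E)%E =
     (\int[q x]_y limn (fun k => (resolvent_iter k y)%:E))%E).
    apply: cvg_monotone_convergence => //.
    - by move=> k; apply/measurable_EFinP; case: (unit_valued_iter k).
    - by move=> k y _; rewrite lee_fin; case: (unit_valued_iter k) => _ /(_ y) /andP[].
    - by move=> y _ a b ab; rewrite lee_fin; exact: iter_nondecreasing.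
  by apply: eq_integral => y _; rewrite EFin_lim//; exact: iter_cvg.
have c1 : resolvent_step (resolvent_iter k) x @[k --> \oo] --> resolvent_step resolvent x.
  apply: cvgMl; apply: cvgD => //; apply: cvgD; first exact: cvg_cst.
  by apply: cvgMr; exact: iter_cvg.
have c2 : resolvent_step (resolvent_iter k) x @[k --> \oo] --> resolvent x.
  have := @iter_cvg x; rewrite -/(resolvent x) => cx.
  by rewrite -(cvg_shiftS (resolvent_iter ^~ x)) in cx.
have E : resolvent x = resolvent_step resolvent x by exact: (cvg_unique _ c2 c1).
rewrite real_generatorE//.
have : (lam + M) * resolvent x = (lam + M) * resolvent_step resolvent x by rewrite -E.
rewrite /resolvent_step [in RHS]mulrC divfK ?gt_eqF// -/(n x); lra.
Qed.

End resolvent.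

(** * The test function for the upper bound *)

Section bounded_measurable.
Context {R : realType} {d : measure_display} {S : measurableType d}.
Implicit Types f g : S -> R.

Definition bounded_measurable f := measurable_fun setT f /\ sup_bounded f.

Lemma bounded_measurable_cst (c : R) : bounded_measurable (fun _ : S => c).
Proof. by split => //; exists `|c|. Qed.

Lemma bounded_measurable_indic (A : set S) :
  measurable A -> bounded_measurable (\1_A : S -> R).
Proof.
move=> mA; split => //; exists 1 => x.
by rewrite indicE; case: (x \in A); rewrite ?normr1 ?normr0.
Qed.

Lemma bounded_measurableD f g : bounded_measurable f -> bounded_measurable g ->
  bounded_measurable (fun x => f x + g x).
Proof.
move=> [mf [B fB]] [mg [C gC]]; split; first exact: measurable_funD.
by exists (B + C) => x; rewrite (le_trans (ler_normD _ _))// lerD.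
Qed.

Lemma bounded_measurableM f g : bounded_measurable f -> bounded_measurable g ->
  bounded_measurable (fun x => f x * g x).
Proof.
move=> [mf [B fB]] [mg [C gC]]; split; first exact: measurable_funM.
by exists (B * C) => x; rewrite normrM ler_pM.
Qed.

Lemma bounded_measurableB f g : bounded_measurable f -> bounded_measurable g ->
  bounded_measurable (fun x => f x - g x).
Proof.
move=> [mf [B fB]] [mg [C gC]]; split; first exact: measurable_funB.
by exists (B + C) => x; rewrite (le_trans (ler_normB _ _))// lerD.
Qed.

Lemma bounded_measurable_integrable (nu : {measure set S -> \bar R}) f :
  (nu setT < +oo)%E -> bounded_measurable f -> nu.-integrable setT (EFin \o f).
Proof. by move=> nuoo [mf bf]; exact: integrable_sup_bounded. Qed.

End bounded_measurable.

Section cheeger_upper_real.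
Context {R : realType} {d : measure_display} {S : measurableType d}.
Variables (q : R.-fker S ~> S) (mu : probability S R) (M e : R) (A : set S).
Hypothesis q_le : forall x, (q x setT <= M%:E)%E.
Hypothesis inv : real_invariant q mu.
Hypotheses (M_gt0 : 0 < M) (e_gt0 : 0 < e) (mA : measurable A).
Hypothesis A_half : (mu A <= (2^-1)%:E)%E.
Hypothesis A_flow : (\int[mu]_(x in A) q x (~` A) <= e%:E * mu A)%E.

Let q_lty x : (q x setT < +oo)%E.
Proof. by rewrite (le_lt_trans (q_le x)) ?ltry. Qed.

Let qi x (f : S -> R) : bounded_measurable f ->
  (q x).-integrable setT (EFin \o f).
Proof. by move=> bf; exact: bounded_measurable_integrable. Qed.

Let mui (f : S -> R) : bounded_measurable f -> mu.-integrable setT (EFin \o f).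
Proof.
have muoo : (mu setT < +oo)%E by rewrite probability_setT ltry.
exact: bounded_measurable_integrable.
Qed.

Lemma bounded_measurable_kernel B : measurable B ->
  bounded_measurable (fun x => fine (q x B)).
Proof.
move=> mB; split; first by apply: measurableT_comp => //; exact: measurable_kernel.
exists M => x; rewrite ger0_norm ?fine_ge0// -lee_fin fineK.
  by rewrite (le_trans _ (q_le x)) ?le_measure ?inE.
by rewrite ge0_fin_numE// (le_lt_trans _ (q_lty x)) ?le_measure ?inE.
Qed.

Lemma bounded_measurable_generator f : bounded_measurable f ->
  bounded_measurable (real_generator q f).
Proof.
move=> bf; have [mf [B fB]] := bf; split; first exact: measurable_real_generator.
exists (2 * B * M) => x.
have bx : bounded_measurable (fun y => f y - f x).
  by apply: bounded_measurableB => //; exact: bounded_measurable_cst.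
apply: le_trans (le_normr_Rintegral measurableT (qi x bx)) _.
have B0 : 0 <= B := le_trans (normr_ge0 _) (fB x).
apply: (@le_trans _ _ (\int[q x]_y (2 * B))).
  apply: le_Rintegral => //.
  - exact: integrable_norm (qi x bx).
  - exact: qi (bounded_measurable_cst _).
  - move=> y _; rewrite (le_trans (ler_normB _ _))//.
    by rewrite mulr_natl mulr2n lerD.
rewrite Rintegral_cst// ler_wpM2l ?mulr_ge0//.
by rewrite -lee_fin fineK// ge0_fin_numE.
Qed.

Let p := fine (mu A).
Let lam := 8 * e.
Let lam_gt0 : 0 < lam. Proof. by rewrite mulr_gt0. Qed.
Let v := resolvent q M lam A.

Let bv : bounded_measurable v.
Proof.
split; first exact: measurable_resolvent.
by exists 1 => x; rewrite ger0_norm ?resolvent_ge0 ?resolvent_le1.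
Qed.

Let bA := @bounded_measurable_indic R d S A mA.

Let genE x : real_generator q v x = lam * (v x - \1_A x).
Proof. by rewrite -(resolventE q_le M_gt0 lam_gt0 mA). Qed.

Let v01 x : 0 <= v x <= 1.
Proof. by rewrite resolvent_ge0 ?resolvent_le1. Qed.

Let integral_indicA : \int[mu]_x \1_A x = p.
Proof. by rewrite /Rintegral integral_indic// setIT. Qed.

Let integral_v : \int[mu]_x v x = p.
Proof.
have : \int[mu]_x real_generator q v x = 0 by apply: inv; case: bv.
under eq_Rintegral do rewrite genE.
rewrite RintegralZl//; last exact: mui (bounded_measurableB bv bA).
rewrite RintegralB//; [|exact: mui|exact: mui].
by move=> /eqP; rewrite mulf_eq0 gt_eqF//= subr_eq0 integral_indicA => /eqP.
Qed.

(** [<v, L v> <= 0] for invariant [mu], because [v L v <= L (v^2) / 2] pointwise;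
    here [L v = lam (v - 1_A)]. *)
Let energy_le : \int[mu]_x (v x * v x) <= \int[mu]_x (\1_A x * v x).
Proof.
have bvv := bounded_measurableM bv bv.
have bAv := bounded_measurableM bA bv.
rewrite -subr_le0 -RintegralB//; [|exact: mui|exact: mui].
have H : \int[mu]_x (v x * real_generator q v x) <=
    \int[mu]_x (2^-1 * real_generator q (fun y => v y * v y) x).
  apply: le_Rintegral => //.
  - exact: mui (bounded_measurableM bv (bounded_measurable_generator bv)).
  - apply: mui; apply: bounded_measurableM; first exact: bounded_measurable_cst.
    exact: bounded_measurable_generator.
  move=> x _; rewrite /real_generator.
  have b1 := bounded_measurableB bv (bounded_measurable_cst (v x)).
  have b2 := bounded_measurableB bvv (bounded_measurable_cst (v x * v x)).
  rewrite -!RintegralZl//; [|exact: (qi x b2)|exact: (qi x b1)].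
  apply: le_Rintegral => //.
  - exact: qi (bounded_measurableM (bounded_measurable_cst _) b1).
  - exact: qi (bounded_measurableM (bounded_measurable_cst _) b2).
  - by move=> y _; have := sqr_ge0 (v x - v y); nra.
rewrite RintegralZl// ?inv ?mulr0 in H; [|by case: bvv|by case: bvv|]; last first.
  exact: mui (bounded_measurable_generator bvv).
move: H; under eq_Rintegral do rewrite genE mulrCA.
rewrite RintegralZl//; last first.
  exact: mui (bounded_measurableM bv (bounded_measurableB bv bA)).
rewrite pmulr_rle0//.
by under eq_Rintegral do rewrite mulrBr [v _ * \1_A _]mulrC.
Qed.

(** Invariance tested on the indicator of [A]: the flows through the boundary of
    [A] in the two directions agree. *)
Let flow_in_le :
  \int[mu]_x ((1 - \1_A x) * fine (q x A)) <= e * p.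
Proof.
have mAc : measurable (~` A) by exact: measurableC.
have bAc := bounded_measurableM bA (bounded_measurable_kernel mAc).
have bB := bounded_measurableM (bounded_measurableB (bounded_measurable_cst 1) bA)
  (bounded_measurable_kernel mA).
have qfin x B : measurable B -> q x B \is a fin_num.
  by move=> mB; rewrite ge0_fin_numE// (le_lt_trans _ (q_lty x)) ?le_measure ?inE.
have : \int[mu]_x real_generator q \1_A x = 0 by apply: inv; case: bA.
rewrite (@eq_Rintegral _ _ _ mu setT (fun x =>
   (1 - \1_A x) * fine (q x A) - \1_A x * fine (q x (~` A)))); last first.
  move=> x _; rewrite real_generatorE//; last exact: qi.
  rewrite {1}/Rintegral integral_indic// setIT.
  have -> : fine (q x setT) = fine (q x A) + fine (q x (~` A)).
    by rewrite -(setUv A) measureU ?setICr// fineD// qfin.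
  ring.
rewrite RintegralB//; [|exact: mui|exact: mui].
move=> /eqP; rewrite subr_eq0 => /eqP ->.
rewrite -lee_fin fineK ?(integrable_fin_num _ (mui bAc))//.
rewrite EFinM /p fineK ?fin_num_measure//; apply: le_trans A_flow.
rewrite [leRHS]integral_mkcond le_eqVlt; apply/orP; left; apply/eqP.
apply: eq_integral => x _; rewrite patchE indicE.
by case: (x \in A); rewrite ?mul1r ?mul0r// fineK// qfin.
Qed.

(** [1_A L v >= L (1_A v) - 1_(A^c) q(x, A)] pointwise, since [0 <= v <= 1]; the
    first term on the right has integral zero. *)
Let inner_lower : - (e * p) <= \int[mu]_x (\1_A x * real_generator q v x).
Proof.
have bAv := bounded_measurableM bA bv.
have bAL := bounded_measurableM bA (bounded_measurable_generator bv).
have bB := bounded_measurableM (bounded_measurableB (bounded_measurable_cst 1) bA)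
  (bounded_measurable_kernel mA).
have bL := bounded_measurable_generator bAv.
have : \int[mu]_x real_generator q (fun y => \1_A y * v y) x <=
    \int[mu]_x (\1_A x * real_generator q v x + (1 - \1_A x) * fine (q x A)).
  apply: le_Rintegral => //; [exact: mui|exact: mui (bounded_measurableD bAL bB)|].
  move=> x _.
  have bAvx := bounded_measurableB bAv (bounded_measurable_cst (\1_A x * v x)).
  have [xA|xA] := boolP (x \in A).
    have A1 : (\1_A x : R) = 1 by rewrite indicE xA.
    rewrite A1 mul1r subrr mul0r addr0; apply: le_Rintegral => //.
    - exact: qi bAvx.
    - exact: qi (bounded_measurableB bv (bounded_measurable_cst (v x))).
    - move=> y _; rewrite A1 mul1r lerD2r; have [v0 _] := andP (v01 y).
      by rewrite indicE; case: (y \in A); rewrite ?mul1r ?mul0r.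
  have A0 : (\1_A x : R) = 0 by rewrite indicE (negbTE xA).
  rewrite A0 mul0r add0r subr0 mul1r.
  have -> : fine (q x A) = \int[q x]_y \1_A y.
    by rewrite /Rintegral integral_indic// setIT.
  apply: le_Rintegral => //; [exact: qi bAvx|exact: qi bA|].
  move=> y _; rewrite A0 mul0r subr0.
  by rewrite ler_piMr//; case/andP: (v01 y).
rewrite inv; [|by case: bAv|by case: bAv].
rewrite RintegralD//; [|exact: mui|exact: mui].
by have := flow_in_le; lra.
Qed.

(** The resolvent [v] keeps the mean of [1_A], so subtracting [mu A] centres it. *)
Definition cheeger_test_function (x : S) : R := v x - p.

(** Write [a = int_A v] and [b = int v^2]. The loss of mass [lam (p - a)] on [A] is at
    most the flow [e p], hence [a >= 7 p / 8] as [lam = 8 e]; with [b <= a] this gives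
    [|v - 1_A|^2 = b - 2 a + p <= p / 8]. As this is nonnegative,
    [|v - p|^2 = b - p^2 >= 2 a - p - p^2 >= p / 4], where [p <= 1/2]. *)
Lemma cheeger_test_functionP : [/\ bounded_measurable cheeger_test_function,
  \int[mu]_x cheeger_test_function x = 0,
  p / 4 <= \int[mu]_x (cheeger_test_function x ^+ 2) &
  \int[mu]_x (real_generator q cheeger_test_function x ^+ 2) <= 8 * e ^+ 2 * p].
Proof.
have bp := bounded_measurable_cst p (S := S).
have bAv := bounded_measurableM bA bv.
have bvv := bounded_measurableM bv bv.
have ip (k : R) : \int[mu]_(_ in [set: S]) k = k.
  rewrite Rintegral_cst// -[RHS]mulr1; congr (_ * _).
  exact: (congr1 fine (probability_setT mu)).
have p0 : 0 <= p by exact: fine_ge0.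
have p2 : p <= 2^-1 by rewrite -lee_fin fineK ?fin_num_measure.
pose a := \int[mu]_x (\1_A x * v x); pose b := \int[mu]_x (v x * v x).
have b2Av := bounded_measurableM (bounded_measurable_cst (S := S) 2) bAv.
have b2v := bounded_measurableM (bounded_measurable_cst (S := S) (2 * p)) bv.
have bpp := bounded_measurable_cst (p ^+ 2) (S := S).
have a_lower : 7 / 8 * p <= a.
  have := inner_lower.
  have -> : \int[mu]_x (\1_A x * real_generator q v x) = lam * (a - p).
    rewrite /a -integral_indicA -RintegralB//; [|exact: mui|exact: mui].
    rewrite -RintegralZl//; last exact: mui (bounded_measurableB bAv bA).
    apply: eq_Rintegral => x _; rewrite genE indicE.
    by case: (x \in A); rewrite /= ?mulr1n ?mulr0n; ring.
  rewrite /lam => H; have {}H : e * (- p) <= e * (8 * (a - p)) by lra.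
  by rewrite ler_pM2l// in H; lra.
have sq_dist : \int[mu]_x ((v x - \1_A x) ^+ 2) = b - 2 * a + p.
  transitivity (\int[mu]_x (v x * v x - 2 * (\1_A x * v x) + \1_A x)).
    apply: eq_Rintegral => x _; rewrite indicE.
    by case: (x \in A); rewrite /= ?mulr1n ?mulr0n; ring.
  rewrite RintegralD//; [|exact: mui (bounded_measurableB bvv b2Av)|exact: mui].
  rewrite RintegralB//; [|exact: mui|exact: mui].
  by rewrite RintegralZl ?integral_indicA//; exact: mui.
have sq_dist_ge0 : 0 <= b - 2 * a + p.
  by rewrite -sq_dist; apply: Rintegral_ge0 => x _; exact: sqr_ge0.
split.
- exact: bounded_measurableB.
- by rewrite RintegralB ?integral_v ?ip ?subrr//; exact: mui.
- have -> : \int[mu]_x (cheeger_test_function x ^+ 2) = b - p ^+ 2.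
    transitivity (\int[mu]_x (v x * v x - 2 * p * v x + p ^+ 2)).
      by apply: eq_Rintegral => x _; rewrite /cheeger_test_function; ring.
    rewrite RintegralD//; [|exact: mui (bounded_measurableB bvv b2v)|exact: mui].
    rewrite RintegralB//; [|exact: mui|exact: mui].
    by rewrite RintegralZl ?integral_v ?ip//; [rewrite -/b; ring|exact: mui].
  nra.
- have -> : \int[mu]_x (real_generator q cheeger_test_function x ^+ 2) =
      lam ^+ 2 * (b - 2 * a + p).
    have bd := bounded_measurableB bv bA.
    rewrite -sq_dist -RintegralZl//; last exact: mui (bounded_measurableM bd bd).
    apply: eq_Rintegral => x _; rewrite -exprMn -genE; congr (_ ^+ 2).
    apply: eq_Rintegral => y _; rewrite /cheeger_test_function; ring.
  have H : b - 2 * a + p <= p / 8 by have := energy_le; rewrite -/a -/b; lra.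
  rewrite -(ler_pM2l (exprn_gt0 2 lam_gt0)) in H; apply: le_trans H _.
  by rewrite /lam; nra.
Qed.

End cheeger_upper_real.

(** * From the truncated kernel to the jump process *)

Section truncation.
Context {R : realType} {d : measure_display} {S : measurableType d}.
Variables (q : R.-ker S ~> S) (mu : probability S R) (M : {nonneg R}).
Hypothesis q_finite : forall x, (q x setT < +oo)%E.
Hypothesis q_le : {ae mu, forall x, (q x setT <= M%:num%:E)%E}.

(** The rates are finite but not uniformly bounded, so the generator is the
    pointwise limit of the generators of the truncations at level [n]. *)
Lemma measurable_real_generator_ker (f : S -> R) : measurable_fun setT f ->
  measurable_fun setT (real_generator q f).
Proof.
move=> mf.
pose F (n : nat) : S -> R := real_generator (truncated_kernel q (NngNum (ler0n R n))%:num) f.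
apply: (measurable_fun_cvg (h := F)).
  by move=> n; exact: measurable_real_generator.
move=> x _; apply: cvg_near_cst; near=> n.
rewrite /F /real_generator truncated_kernel_in//.
rewrite /bounded_rate/= -[X in (X <= _)%E]fineK ?ge0_fin_numE// lee_fin.
by near: n; exact: nbhs_infty_ger.
Unshelve. all: by end_near. Qed.

Lemma real_generator_truncated_ae (f : S -> R) :
  {ae mu, forall x, real_generator q f x =
    real_generator (truncated_kernel q M%:num) f x}.
Proof.
apply: filterS q_le => x qx.
by rewrite /real_generator truncated_kernel_in.
Qed.

Lemma edge_flow_truncated (A B : set S) : measurable A -> measurable B ->
  edge_flow q mu A B = (\int[mu]_(x in A) truncated_kernel q M%:num x B)%E.
Proof.
move=> mA mB; apply: ge0_ae_eq_integral => //.
- by apply: measurable_funTS; exact: measurable_kernel.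
- by apply: measurable_funTS; exact: measurable_kernel.
- apply: filterS q_le => x qx _.
  by rewrite truncated_kernel_in.
Qed.

Lemma jump_generatorE (f : S -> R[i]) x : jump_generator q f x =
  Complex (real_generator q (fun y => complex.Re (f y)) x)
          (real_generator q (fun y => complex.Im (f y)) x).
Proof.
rewrite /jump_generator /cintegral /real_generator.
by congr Complex; apply: eq_Rintegral => y _; case: (f x) (f y) => a b [].
Qed.

Lemma real_invariant_truncated : invariant_measure q mu ->
  real_invariant (truncated_kernel q M%:num) mu.
Proof.
move=> inv h mh [B hB].
pose hc x : R[i] := Complex (h x) 0.
have mhc : cmeasurable hc by split => //=; exact: measurable_cst.
have bhc : cbounded hc by exists B => x; rewrite /= expr0n/= addr0 sqrtr_sqr.
have /= := congr1 (@complex.Re R) (inv hc mhc bhc).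
rewrite -[X in X = _ -> _]/(\int[mu]_x real_generator q h x) /Rintegral => <-.
congr fine; apply: ae_eq_integral => //.
- by apply/measurable_EFinP; exact: measurable_real_generator.
- by apply/measurable_EFinP; exact: measurable_real_generator_ker.
- by apply: filterS (real_generator_truncated_ae h) => x E _; rewrite E.
Qed.

Lemma sq_generator_truncated (u : S -> R) : measurable_fun setT u ->
  (\int[mu]_x (real_generator (truncated_kernel q M%:num) u x ^+ 2)%:E =
   \int[mu]_x (real_generator q u x ^+ 2)%:E)%E.
Proof.
move=> mu'; apply: ae_eq_integral => //.
- by apply/measurable_EFinP; apply: measurable_funX; exact: measurable_real_generator.
- by apply/measurable_EFinP; apply: measurable_funX; exact: measurable_real_generator_ker.
- by apply: filterS (real_generator_truncated_ae u) => x E _; rewrite E.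
Qed.

End truncation.

Section complex_norm.
Context {R : realType} {d : measure_display} {S : measurableType d}.
Variable nu : {measure set S -> \bar R}.
Implicit Types f : S -> R[i].

Definition sq_norm f : \bar R :=
  (\int[nu]_x (complex.Re (f x) ^+ 2 + complex.Im (f x) ^+ 2)%:E)%E.

Lemma sq_norm_ge0 f : (0 <= sq_norm f)%E.
Proof. by apply: integral_ge0 => x _; rewrite lee_fin addr_ge0 ?sqr_ge0. Qed.

Lemma L2normE f : L2norm nu f = sqrte (sq_norm f).
Proof.
rewrite -poweR12_sqrt ?sq_norm_ge0// /L2norm unlock /Lnorm; congr poweR.
apply: eq_integral => x _ /=; case: (f x) => a b /=.
rewrite (ger0_norm (sqrtr_ge0 _)) powR_mulrn ?sqrtr_ge0// sqr_sqrtr//.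
by rewrite addr_ge0 ?sqr_ge0.
Qed.

Lemma sq_normE f : cmeasurable f -> (sq_norm f =
  \int[nu]_x (complex.Re (f x) ^+ 2)%:E + \int[nu]_x (complex.Im (f x) ^+ 2)%:E)%E.
Proof. by move=> [mr mi]; rewrite /sq_norm ge0_integralD_real//; side. Qed.

Lemma sq_norm_eq0 f : cmeasurable f -> sq_norm f = 0%E ->
  {ae nu, forall x, f x = 0}.
Proof.
move=> [mr mi] f0.
pose g x := complex.Re (f x) ^+ 2 + complex.Im (f x) ^+ 2.
have g0 x : 0 <= g x by rewrite addr_ge0 ?sqr_ge0.
have mg : measurable_fun setT (EFin \o g).
  by apply/measurable_EFinP; rewrite /g; side.
have [+ _] := ae_eq_integral_abs nu measurableT mg.
rewrite (eq_integral (EFin \o g)); last first.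
  by move=> x _; rewrite /= ger0_norm.
move=> /(_ f0); apply: filterS => x /(_ I) /=.
rewrite /g; case: (f x) => a b /= [] /eqP; rewrite paddr_eq0 ?sqr_ge0// !sqrf_eq0.
by case/andP => /eqP -> /eqP ->.
Qed.

End complex_norm.

(** * The two bounds on the singular-value gap *)

Section cheeger.
Context {R : realType} {d : measure_display} {S : measurableType d}.
Variables (q : R.-ker S ~> S) (mu : probability S R) (M : {nonneg R}).
Hypothesis q_finite : forall x, (q x setT < +oo)%E.
Hypothesis mu_inv : invariant_measure q mu.
Hypothesis M_gt0 : 0 < M%:num.
Hypothesis q_le : {ae mu, forall x, (q x setT <= M%:num%:E)%E}.

Let q' : R.-fker S ~> S := truncated_kernel q M%:num.

Let q'_le x : (q' x setT <= M%:num%:E)%E.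
Proof. exact: truncated_kernel_le. Qed.

Let inv' : real_invariant q' mu.
Proof. exact: real_invariant_truncated. Qed.

Lemma cheeger_constant_isoperimetry (c : R) : 0 <= c ->
  (c%:E <= cheeger_constant q mu)%E -> forall A, measurable A ->
  (mu A <= (2^-1)%:E)%E -> (c%:E * mu A <= \int[mu]_(x in A) q' x (~` A))%E.
Proof.
move=> c0 cxi A mA A2.
have mAc : measurable (~` A) by exact: measurableC.
rewrite -(edge_flow_truncated q_le mA mAc).
have [A0|A0] := eqVneq (mu A) 0%E.
  by rewrite A0 mule0 integral_ge0.
have A0' : (0 < mu A)%E by rewrite lt0e A0 measure_ge0.
have r0 : 0 < fine (mu A) by rewrite fine_gt0// A0' ltey_eq fin_num_measure.
have : (c%:E <= edge_flow q mu A (~` A) / mu A)%E.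
  by apply: le_trans cxi _; apply: ereal_inf_lbound; exists A.
have -> : mu A = (fine (mu A))%:E by rewrite fineK ?fin_num_measure.
by rewrite inver gt_eqF// lee_pdivlMr.
Qed.

Lemma sq_norm_generatorE f : cmeasurable f ->
  sq_norm mu (jump_generator q f) =
  (\int[mu]_x (real_generator q' (fun y => complex.Re (f y)) x ^+ 2)%:E +
   \int[mu]_x (real_generator q' (fun y => complex.Im (f y)) x ^+ 2)%:E)%E.
Proof.
move=> [mr mi].
have mr' := measurable_real_generator_ker q_finite mr.
have mi' := measurable_real_generator_ker q_finite mi.
rewrite (sq_generator_truncated q_finite q_le mr).
rewrite (sq_generator_truncated q_finite q_le mi).
rewrite -ge0_integralD_real; try by side.
by apply: eq_integral => x _; rewrite jump_generatorE.
Qed.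

Lemma cheeger_gap_lower (c : R) : 0 < c -> (c%:E <= cheeger_constant q mu)%E ->
  ((c ^+ 2 / (2 * M%:num))%:E <= singular_value_gap q mu)%E.
Proof.
move=> c0 cxi; apply: le_ereal_inf_tmp => _ [f [[[mf f2] f0] fn0 ->]].
have iso := cheeger_constant_isoperimetry (ltW c0) cxi.
have [mr mi] := mf.
have F0 := sq_norm_ge0 mu f.
have Foo : (sq_norm mu f < +oo)%E.
  by move: f2; rewrite L2normE; case: (sq_norm mu f) => [r||]// _; rewrite ltry.
have Fn0 : sq_norm mu f != 0%E.
  by apply/eqP => Fe0; apply: fn0; exact: sq_norm_eq0.
have FE := sq_normE mu mf.
set k := c ^+ 2 / (2 * M%:num).
have k0 : 0 <= k by rewrite divr_ge0 ?sqr_ge0// mulr_ge0// ltW.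
have lower : ((k ^+ 2)%:E * sq_norm mu f <= sq_norm mu (jump_generator q f))%E.
  have r0 : (0 <= \int[mu]_x (complex.Re (f x) ^+ 2)%:E)%E.
    by apply: integral_ge0 => x _; rewrite lee_fin sqr_ge0.
  have i0 : (0 <= \int[mu]_x (complex.Im (f x) ^+ 2)%:E)%E.
    by apply: integral_ge0 => x _; rewrite lee_fin sqr_ge0.
  rewrite FE sq_norm_generatorE// ge0_muleDr//; apply: leeD.
    apply: (real_generator_lower q'_le inv' c0 M_gt0 iso mr).
      by apply: le_lt_trans Foo; rewrite FE leeDl.
    by case: f0.
  apply: (real_generator_lower q'_le inv' c0 M_gt0 iso mi).
    by apply: le_lt_trans Foo; rewrite FE leeDr.
  by case: f0.
rewrite !L2normE.
have {lower} : (k%:E * sqrte (sq_norm mu f) <= sqrte (sq_norm mu (jump_generator q f)))%E.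
  have <- : sqrte ((k ^+ 2)%:E * sq_norm mu f) = (k%:E * sqrte (sq_norm mu f))%E.
    by rewrite sqrteM ?lee_fin ?sqr_ge0//= sqrtr_sqr ger0_norm.
  by rewrite lee_sqrt// sq_norm_ge0.
case: (sq_norm mu f) F0 Foo Fn0 => // r r0 _ rn0 /=.
have sr0 : 0 < Num.sqrt r by rewrite sqrtr_gt0 lt0r rn0 -lee_fin.
by rewrite inver gt_eqF// lee_pdivlMr.
Qed.

Lemma cheeger_gap_upper (e : R) : 0 < e -> (cheeger_constant q mu < e%:E)%E ->
  (singular_value_gap q mu <= (36 / 5 * e)%:E)%E.
Proof.
move=> e0 /ereal_inf_lt[_ [A [mA A0 A2 ->]] Ae].
have mAc : measurable (~` A) by exact: measurableC.
pose p := fine (mu A); have p0 : 0 < p by rewrite fine_gt0// A0 ltey_eq fin_num_measure.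
have flow : (\int[mu]_(x in A) q' x (~` A) <= e%:E * mu A)%E.
  rewrite -(edge_flow_truncated q_le mA mAc); apply: ltW.
  have {Ae} : (edge_flow q mu A (~` A) / p%:E < e%:E)%E.
    by rewrite /p fineK ?fin_num_measure.
  rewrite inver gt_eqF// lte_pdivrMr// => /lt_le_trans; apply.
  by rewrite /p fineK ?fin_num_measure.
have := cheeger_test_functionP q'_le inv' M_gt0 e0 mA A2 flow.
set u := cheeger_test_function _ _ _ _ _; rewrite -/p => -[bu u0 u_lower Lu_upper].
have [mu' [B uB]] := bu.
pose f x : R[i] := Complex (u x) 0.
have mf : cmeasurable f by split => //=; exact: measurable_cst.
have muoo : (mu setT < +oo)%E by rewrite probability_setT ltry.
have bu2 : bounded_measurable (fun x => u x ^+ 2) by exact: bounded_measurableM.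
have iu2 := bounded_measurable_integrable muoo bu2.
have FE : sq_norm mu f = (\int[mu]_x (u x ^+ 2))%:E.
  rewrite fineK ?(integrable_fin_num _ iu2)//.
  by apply: eq_integral => x _; rewrite /= expr0n/= addr0.
have bL := bounded_measurable_generator q'_le bu.
have bL2 : bounded_measurable (fun x => real_generator q' u x ^+ 2).
  exact: bounded_measurableM.
have iL2 := bounded_measurable_integrable muoo bL2.
have LE : sq_norm mu (jump_generator q f) =
    (\int[mu]_x (real_generator q' u x ^+ 2))%:E.
  rewrite sq_norm_generatorE// fineK ?(integrable_fin_num _ iL2)//=.
  rewrite [X in (_ + X)%E]integral0_eq ?adde0// => x _.
  rewrite /real_generator (@eq_Rintegral _ _ _ _ setT (cst 0)).
    by rewrite Rintegral_cst// mul0r expr0n.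
  by move=> y _; rewrite subrr.
set F := \int[mu]_x (u x ^+ 2) in FE u_lower.
set L := \int[mu]_x (real_generator q' u x ^+ 2) in LE Lu_upper.
have F0 : 0 < F by apply: lt_le_trans u_lower; rewrite divr_gt0.
have sF0 : 0 < Num.sqrt F by rewrite sqrtr_gt0.
apply: (@le_trans _ _ (L2norm mu (jump_generator q f) / L2norm mu f)%E).
  apply: ereal_inf_lbound; exists f; split => //.
    split; first by split; rewrite // L2normE FE/= ltry.
    by rewrite /cintegral /= u0 Rintegral_cst// mul0r.
  move=> f0; move: F0; rewrite lt_neqAle => /andP[/eqP + _]; apply.
  apply/esym; apply: (congr1 fine (x := (\int[mu]_x (u x ^+ 2)%:E)%E) (y := 0%E)).
  rewrite (ae_eq_integral (cst 0%E)) ?integral_cst ?mul0e//.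
    by case: iu2 => /integrableP[].
  by apply: filterS f0 => x [-> ] _ /=; rewrite expr0n.
rewrite !L2normE FE LE/= inver gt_eqF// lee_pdivrMr// -EFinM lee_fin.
have k0 : 0 <= 36 / 5 * e by rewrite mulr_ge0// ltW.
rewrite -[36 / 5 * e](ger0_norm k0) -sqrtr_sqr -sqrtrM ?sqr_ge0//.
apply: ler_wsqrtr; apply: le_trans Lu_upper _.
have : 0 <= e ^+ 2 * (F - p / 4) by rewrite mulr_ge0 ?sqr_ge0// subr_ge0.
have : 0 <= e ^+ 2 * p by rewrite mulr_ge0 ?sqr_ge0// ltW.
by rewrite exprMn; nra.
Qed.

End cheeger.

Theorem theorem5 (R : realType) (d : measure_display) (S : measurableType d)
    (S_borel : standard_borel R S)
    (q : R.-ker S ~> S) (q_finite : forall x, (q x setT < +oo)%E)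
    (mu : probability S R) (mu_inv : invariant_measure q mu)
    (qmax : R) (qmax_gt0 : 0 < qmax)
    (q_le : {ae mu, forall x, (q x setT <= qmax%:E)%E}) :
  let gamma := singular_value_gap q mu in
  let xi := cheeger_constant q mu in
  (xi ^+ 2 / (2 * qmax)%:E <= gamma)%E /\ (gamma <= (36 / 5)%:E * xi)%E.
Proof.
move=> gamma xi; pose M := NngNum (ltW qmax_gt0).
have gamma0 : (0 <= gamma)%E.
  apply: le_ereal_inf_tmp => _ [f [_ _ ->]].
  by rewrite mule_ge0 ?Lnorm_ge0// inve_ge0 Lnorm_ge0.
have xi0 : (0 <= xi)%E.
  apply: le_ereal_inf_tmp => _ [A [_ _ _ ->]].
  by rewrite mule_ge0 ?inve_ge0// integral_ge0.
have lower (c : R) : 0 < c -> (c%:E <= xi)%E -> ((c ^+ 2 / (2 * qmax))%:E <= gamma)%E.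
  by move=> c0 cxi; exact: (cheeger_gap_lower (M := M)).
have upper (e : R) : 0 < e -> (xi < e%:E)%E -> (gamma <= (36 / 5 * e)%:E)%E.
  by move=> e0 xie; exact: (cheeger_gap_upper (M := M)).
have q20 : 0 < 2 * qmax by rewrite mulr_gt0.
rewrite inver gt_eqF//.
case: (xi) xi0 lower upper => [x||]// x0 lower upper; split.
- rewrite -EFin_expe -EFinM.
  move: x0; rewrite lee_fin le_eqVlt => /predU1P[<-|x0]; last exact: lower.
  by rewrite expr0n mul0r.
- apply/lee_addgt0Pr => eps eps0.
  have e0 : 0 < x + 5 / 36 * eps by rewrite ltr_wpDl// mulr_gt0.
  have xe : (x%:E < (x + 5 / 36 * eps)%:E)%E by rewrite lte_fin ltrDl mulr_gt0.
  apply: le_trans (upper _ e0 xe) _.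
  by rewrite -EFinM -EFinD lee_fin; lra.
(* An infinite Cheeger constant exceeds every real [c]; this one rules out a
   finite gap [g], as [c ^+ 2 >= c > 2 * qmax * g]. *)
- case: (gamma) lower gamma0 => [g||]// lower g0; last by rewrite leey.
  rewrite lee_fin in g0.
  have t0 : 0 <= 2 * qmax * g by rewrite mulr_ge0// ltW.
  have c0 : 0 < 1 + 2 * qmax * g by rewrite ltr_pwDl.
  have := lower _ c0 (leey _); rewrite lee_fin ler_pdivrMr// [g * _]mulrC.
  by clear -t0 => H; exfalso; move: t0 H; set t := 2 * qmax * g; nra.
- by rewrite gt0_muley ?leey.
Qed.
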